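(* Let $Y=XB^*+C^*+\mathcal E$ with $X\in\mathbb R^{n\times p}$, $B^*\in\mathbb R^{p\times m}$, $C^*\in\mathbb R^{n\times m}$, and $\mathcal E\in\mathbb R^{n\times m}$ having independent and identically distributed $N(0,\sigma^2)$ entries, and let $q=\mathrm{rank}(X)$. Let $$(\hat B,\hat C)=\arg\min_{(B,C)}\ \|Y-XB-C\|_F^2/2+\lambda\|C\|_{2,1}\quad\text{subject to }\mathrm{rank}(B)\le r,$$ with $\lambda=A\sigma(m+\log n)^{1/2}$, where $A$ is a large enough constant. Then $$E\{M(\hat B-B^*,\hat C-C^* )\}\ \lesssim\ M(B-B^*,C-C^* )+\sigma^2+\sigma^2(q+m)r+\sigma^2K^2J(C)(m+\log n)$$ for any $(B,C)\in\mathbb R^{p\times m}\times\mathbb R^{n\times m}$ with $\mathrm{rank}(B)\le r$, provided that, for $\mathcal J=\mathcal J(C)$, $X$ satisfies $$(1+\vartheta)\|C'_{\mathcal J}\|_{2,1}\ \le\ \|C'_{\mathcal J^c}\|_{2,1}+K|\mathcal J|^{1/2}\|(I-\mathcal P_r)C'\|_F$$ for all $C'\in\mathbb R^{n\times m}$ and all orthogonal projection matrices $\mathcal P_r$ whose range is contained in the column space of $X$ and with $\mathrm{rank}(\mathcal P_r)\le2r$, where $K\ge0$ and $\vartheta$ is a positive constant.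
   Context: $M(B,C)=\|XB+C\|_F^2$, with $\|\cdot\|_F$ the Frobenius norm. For $C=(c_1,\ldots,c_n)^T\in\mathbb R^{n\times m}$: $\|C\|_{2,1}=\sum_{i=1}^n\|c_i\|_2$; $\mathcal J(C)=\{i:c_i\neq0\}$, $J(C)=|\mathcal J(C)|$; for $\mathcal J\subset\{1,\ldots,n\}$, $\|C_{\mathcal J}\|_{2,1}=\sum_{i\in\mathcal J}\|c_i\|_2$, and $\mathcal J^c$ is the complement of $\mathcal J$ in $\{1,\ldots,n\}$. $\lesssim$ means that the inequality holds up to a multiplicative constant; this constant and the required size of $A$ may depend on $\vartheta$ (and the multiplicative constant on $A$) but not on $n,m,p,q,r,\sigma,K,X,B^*,C^*,B,C$. *)

(* Defs.v *)
From HB Require Import structures.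
From mathcomp Require Import all_boot all_order all_algebra.
From mathcomp Require Import all_classical all_reals all_analysis.

Set Implicit Arguments.
Unset Strict Implicit.
Unset Printing Implicit Defensive.

Import Order.TTheory GRing.Theory Num.Theory.
Import numFieldNormedType.Exports.

Local Open Scope classical_set_scope.
Local Open Scope ring_scope.

Definition frob (R : realType) (n m : nat) (A : 'M[R]_(n, m)) : R :=
  Num.sqrt (\sum_(i < n) \sum_(j < m) A i j ^+ 2).

Definition norm2_row (R : realType) (n m : nat) (C : 'M[R]_(n, m))
  (i : 'I_n) : R := Num.sqrt (\sum_(j < m) C i j ^+ 2).

Definition norm21_on (R : realType) (n m : nat) (J : {set 'I_n})
  (C : 'M[R]_(n, m)) : R := \sum_(i in J) norm2_row C i.

Definition norm21 (R : realType) (n m : nat) (C : 'M[R]_(n, m)) : R :=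
  \sum_(i < n) norm2_row C i.

Definition row_supp (R : realType) (n m : nat) (C : 'M[R]_(n, m)) :
  {set 'I_n} := [set i : 'I_n | row i C != 0]%SET.

Definition Mloss (R : realType) (n p m : nat) (X : 'M[R]_(n, p))
  (B : 'M[R]_(p, m)) (C : 'M[R]_(n, m)) : R := frob (X *m B + C) ^+ 2.

Definition objective (R : realType) (n p m : nat) (lambda : R)
  (Y : 'M[R]_(n, m)) (X : 'M[R]_(n, p))
  (B : 'M[R]_(p, m)) (C : 'M[R]_(n, m)) : R :=
  frob (Y - X *m B - C) ^+ 2 / 2 + lambda * norm21 C.

Definition is_argmin (R : realType) (n p m : nat) (lambda : R) (r : nat)
  (Y : 'M[R]_(n, m)) (X : 'M[R]_(n, p))
  (Bh : 'M[R]_(p, m)) (Ch : 'M[R]_(n, m)) : Prop :=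
  (\rank Bh <= r)%N /\
  forall (B : 'M[R]_(p, m)) (C : 'M[R]_(n, m)), (\rank B <= r)%N ->
    objective lambda Y X Bh Ch <= objective lambda Y X B C.

Definition orthogonal_projection (R : realType) (n : nat) (Q : 'M[R]_n) :
  Prop := Q^T = Q /\ Q *m Q = Q.

(* [<=%MS] compares row spaces, hence the transposes. *)
Definition colspace_sub (R : realType) (n p1 p2 : nat)
  (A : 'M[R]_(n, p1)) (B : 'M[R]_(n, p2)) : bool := (A^T <= B^T)%MS.

Definition design_condition (R : realType) (n p : nat) (m r : nat)
  (theta K : R) (X : 'M[R]_(n, p)) (J : {set 'I_n}) : Prop :=
  forall (C' : 'M[R]_(n, m)) (Q : 'M[R]_n),
    orthogonal_projection Q -> colspace_sub Q X -> (\rank Q <= 2 * r)%N ->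
    (1 + theta) * norm21_on J C' <=
      norm21_on (~: J)%SET C'
      + K * Num.sqrt (#|J|%:R) * frob ((1%:M - Q) *m C').

Definition mutually_independent (d : measure_display) (T : measurableType d)
  (R : realType) (P : probability T R) (I : finType)
  (Z : I -> {RV P >-> R}) : Prop :=
  forall (S : {set I}) (U : I -> set R), (forall k, measurable (U k)) ->
    P (\bigcap_(k in [set k | k \in S]) Z k @^-1` U k) =
    (\prod_(k in S) P (Z k @^-1` U k))%E.

(* The second argument of [normal_prob] is the standard deviation; for
   [sigma = 0] it is not a Dirac mass, so this is meant for [sigma > 0]. *)
Definition iid_centered_normal (d : measure_display) (T : measurableType d)
  (R : realType) (P : probability T R) (I : finType) (sigma : R)
  (Z : I -> {RV P >-> R}) : Prop :=
  mutually_independent Z /\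
  forall (k : I) (U : set R), measurable U ->
    distribution P (Z k) U = normal_prob 0 sigma U.

(* Main.v *)
(* Comparing the minimizer with (B, C), the noise enters only through the inner
   product <E, X V + W> with rank V <= 2r and W arbitrary.  The group penalty
   l |W|_{2,1} dominates a hard-thresholding penalty, row by row: either the row
   of W may be taken to be 0, or the contribution of the row is at most
   4 (|e_i|^2 - l^2).  Hence, for some row set J depending on E, the penalized
   noise is at most the sum of these contributions over J plus
   <E, D> - |D|^2 / 16, where D is X V with its rows in J erased.  For a fixed J
   these D have rank at most 2r and columns in a space of dimension at most q,
   so D = U W^T, and rounding U and W to lattices gives a net with at most
   64^(2r(q+m)) elements.  Half of the price l^2 |J| pays for a union bound over
   all J.  The design condition is applied only to the orthogonal projection
   onto the column space of X V, for the V of the minimizer. *)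

Require Import Defs.
From mathcomp Require Import all_boot all_order all_algebra.
From mathcomp Require Import all_classical all_reals all_analysis.
From mathcomp Require Import measurable_realfun ring lra.

Set Implicit Arguments.
Unset Strict Implicit.
Unset Printing Implicit Defensive.

Import Order.TTheory GRing.Theory Num.Theory.
Import numFieldNormedType.Exports.

Local Open Scope classical_set_scope.
Local Open Scope ring_scope.

(** * Gaussian moments under independence *)

Import HBNNSimple.

(** Monotone convergence along simple approximations of [f]. The weight [h] stands for a density or
    for the product of the remaining factors; the right-hand side sees [Z] and [h] only through
    weighted integrals of indicators. *)
Lemma ge0_integral_weighted_comp d (T : measurableType d) (R : realType)
    (mu : {measure set T -> \bar R}) (h Z : T -> R) (f : R -> R)
    (f_ : {nnsfun R >-> R}^nat) :
    nondecreasing_seq (f_ : (R -> R)^nat) ->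
    (forall y, EFin \o f_^~ y @ \oo --> (f y)%:E) ->
    measurable_fun [set: T] h -> (forall x, 0 <= h x) ->
    measurable_fun [set: T] Z ->
  (\int[mu]_x (f (Z x) * h x)%:E =
   limn (fun n => \sum_(y \in range (f_ n))
     y%:E * \int[mu]_x (\1_(f_ n @^-1` [set y]) (Z x) * h x)%:E))%E.
Proof.
move=> ndf cvgf mh h0 mZ.
have m1 n y : measurable_fun [set: T]
    (fun x => \1_(f_ n @^-1` [set y]) (Z x) * h x : R).
  by apply: measurable_funM => //; exact: measurableT_comp.
transitivity (limn (fun n => \int[mu]_x (f_ n (Z x) * h x)%:E))%E.
  rewrite -monotone_convergence//.
  - apply: eq_integral => x _; apply/esym/cvg_lim => //.
    under eq_fun do rewrite EFinM.
    by rewrite EFinM; apply: cvgeZr => //; exact: cvgf.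
  - move=> n; apply/measurable_EFinP; apply: measurable_funM => //.
    exact: measurableT_comp.
  - by move=> n x _; rewrite lee_fin mulr_ge0.
  - move=> x _ a b ab; rewrite lee_fin ler_wpM2r//.
    exact/lefP/ndf.
congr (limn _); apply/funext => n.
transitivity (\int[mu]_x \sum_(y \in range (f_ n))
    (y * \1_(f_ n @^-1` [set y]) (Z x) * h x)%:E)%E.
  apply: eq_integral => x _; rewrite fsumEFin// fimfunE.
  by congr EFin; rewrite !fsbig_finite//= big_distrl.
rewrite ge0_integral_fsum//; last 2 first.
- move=> y; under eq_fun do rewrite -mulrA.
  by apply/measurable_EFinP; exact: measurable_funM.
- by move=> y x _; rewrite EFinM mule_ge0 ?lee_fin// -lee_fin nnfun_muleindic_ge0.
apply: eq_fsbigr => y /[!inE] -[z _ <-].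
under eq_integral do rewrite -mulrA EFinM.
rewrite ge0_integralZl//.
- exact/measurable_EFinP.
- by move=> x _; rewrite lee_fin mulr_ge0.
- by rewrite lee_fin.
Qed.

(* Equality on indicators propagates to all nonnegative measurable functions;
   this covers the change of density as well as independence. *)
Lemma ge0_integral_weighted_comp_eq d1 d2 (T1 : measurableType d1)
    (T2 : measurableType d2) (R : realType)
    (mu1 : {measure set T1 -> \bar R}) (mu2 : {measure set T2 -> \bar R})
    (h1 Z1 : T1 -> R) (h2 Z2 : T2 -> R) (f : R -> R) :
    measurable_fun [set: T1] h1 -> (forall x, 0 <= h1 x) ->
    measurable_fun [set: T1] Z1 ->
    measurable_fun [set: T2] h2 -> (forall x, 0 <= h2 x) ->
    measurable_fun [set: T2] Z2 ->
    (forall U : set R, measurable U ->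
      (\int[mu1]_x (\1_U (Z1 x) * h1 x)%:E =
       \int[mu2]_x (\1_U (Z2 x) * h2 x)%:E)%E) ->
    measurable_fun [set: R] f -> (forall y, 0 <= f y) ->
  (\int[mu1]_x (f (Z1 x) * h1 x)%:E = \int[mu2]_x (f (Z2 x) * h2 x)%:E)%E.
Proof.
move=> mh1 h10 mZ1 mh2 h20 mZ2 eq12 mf f0.
have mEf : measurable_fun [set: R] (EFin \o f) by exact/measurable_EFinP.
have ndf := nd_nnsfun_approx measurableT mEf.
have cvgf y : EFin \o (nnsfun_approx measurableT mEf)^~ y @ \oo --> (f y)%:E.
  by apply: (cvg_nnsfun_approx measurableT mEf) => // z _; rewrite lee_fin.
rewrite (ge0_integral_weighted_comp mu1 ndf cvgf)//.
rewrite (ge0_integral_weighted_comp mu2 ndf cvgf)//.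
congr (limn _); apply/funext => n; apply: eq_fsbigr => y _.
by rewrite eq12.
Qed.

(** The weight is 1 under [P] and the density under Lebesgue measure, so the two sides need
    comparing on measurable sets only. *)
Lemma integral_normal_law d (T : measurableType d) (R : realType)
    (P : probability T R) (Z : {RV P >-> R}) (m s : R) (f : R -> R) :
    (forall U, measurable U -> distribution P Z U = normal_prob m s U) ->
    measurable_fun [set: R] f -> (forall y, 0 <= f y) ->
  (\int[P]_w (f (Z w))%:E =
   \int[lebesgue_measure]_x (f x * normal_pdf m s x)%:E)%E.
Proof.
move=> lawZ mf f0.
under eq_integral do rewrite -[f _]mulr1.
apply: (@ge0_integral_weighted_comp_eq _ _ _ _ R P lebesgue_measure
  (cst 1) Z (normal_pdf m s) idfun) => //.
- exact: measurable_normal_pdf.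
- by move=> x; exact: normal_pdf_ge0.
- exact: measurable_id.
move=> U mU.
transitivity (\int[P]_w (\1_(Z @^-1` U) w)%:E)%E.
  by apply: eq_integral => w _; rewrite mulr1.
rewrite integral_indic//; last exact: measurable_funPTI.
rewrite setIT; transitivity (normal_prob m s U); first exact: lawZ.
rewrite /normal_prob [LHS]integral_mkcond; apply: eq_integral => x _.
by rewrite patchE indicE; case: ifPn => _; rewrite ?mul1r ?mul0r.
Qed.

Lemma integral_normal_law_exp_linear d (T : measurableType d) (R : realType)
    (P : probability T R) (Z : {RV P >-> R}) (s t : R) : 0 < s ->
    (forall U, measurable U -> distribution P Z U = normal_prob 0 s U) ->
  (\int[P]_w (expR (t * Z w))%:E = (expR (s ^+ 2 * t ^+ 2 / 2))%:E)%E.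
Proof.
move=> s0 lawZ.
rewrite (@integral_normal_law _ _ _ _ _ 0 s (fun x => expR (t * x)))//; last first.
  apply: measurableT_comp => //; exact: measurable_funM.
(* Completing the square: tilting the centered density by [expR (t * x)] moves its mean to
   [s ^+ 2 * t]. *)
transitivity (\int[lebesgue_measure]_x
    ((expR (s ^+ 2 * t ^+ 2 / 2))%:E * (normal_pdf (s ^+ 2 * t) s x)%:E))%E.
  apply: eq_integral => x _; rewrite -EFinM; congr EFin.
  rewrite !normal_pdfE ?gt_eqF// /normal_fun mulrCA [RHS]mulrCA -!expRD.
  by congr (_ * expR _); field; rewrite gt_eqF.
rewrite ge0_integralZl//; last 2 first.
- by apply/measurable_EFinP; exact: measurable_normal_pdf.
- by move=> x _; rewrite lee_fin normal_pdf_ge0.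
by rewrite integral_normal_pdf mule1.
Qed.

Lemma integral_normal_law_exp_square d (T : measurableType d) (R : realType)
    (P : probability T R) (Z : {RV P >-> R}) (s : R) : 0 < s ->
    (forall U, measurable U -> distribution P Z U = normal_prob 0 s U) ->
  (\int[P]_w (expR (Z w ^+ 2 / (4 * s ^+ 2)))%:E = (Num.sqrt 2)%:E)%E.
Proof.
move=> s0 lawZ.
rewrite (@integral_normal_law _ _ _ _ _ 0 s
  (fun x => expR (x ^+ 2 / (4 * s ^+ 2))))//; last first.
  apply: measurableT_comp => //; apply: measurable_funM => //.
have s2 : Num.sqrt 2 * s != 0 :> R by rewrite mulf_neq0// gt_eqF// sqrtr_gt0.
(* The exponential factor doubles the variance; [Num.sqrt 2] is the ratio of the normalizing
   constants. *)
transitivity (\int[lebesgue_measure]_x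
    ((Num.sqrt 2)%:E * (normal_pdf 0 (Num.sqrt 2 * s) x)%:E))%E.
  apply: eq_integral => x _; rewrite -EFinM; congr EFin.
  have peakE : normal_peak s = Num.sqrt 2 * normal_peak (Num.sqrt 2 * s).
    rewrite /normal_peak exprMn sqr_sqrtr// //.
    rewrite (_ : 2 * s ^+ 2 * pi *+ 2 = 2 * (s ^+ 2 * pi *+ 2)); last by ring.
    rewrite (sqrtrM _ (ler0n _ 2)) invfM mulrA.
    by rewrite divff ?mul1r// gt_eqF// sqrtr_gt0.
  rewrite !normal_pdfE ?(gt_eqF s0)// /normal_fun peakE mulrCA.
  rewrite -mulrA -expRD; congr (_ * (_ * expR _)).
  by rewrite exprMn sqr_sqrtr//; field; rewrite gt_eqF.
rewrite ge0_integralZl//; last 2 first.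
- by apply/measurable_EFinP; exact: measurable_normal_pdf.
- by move=> x _; rewrite lee_fin normal_pdf_ge0.
by rewrite integral_normal_pdf mule1.
Qed.

Lemma independent_integral_prod d (T : measurableType d) (R : realType)
    (P : probability T R) (I : finType) (Z : I -> {RV P >-> R})
    (f : I -> R -> R) (a : I -> R) (A : {set I}) :
    mutually_independent Z ->
    (forall k, measurable_fun [set: R] (f k)) -> (forall k y, 0 <= f k y) ->
    (forall k, (\int[P]_w (f k (Z k w))%:E = (a k)%:E)%E) ->
  (\int[P]_w (\prod_(k in A) f k (Z k w))%:E = (\prod_(k in A) a k)%:E)%E.
Proof.
move=> indZ mf f0 intf.
have a0 k : 0 <= a k.
  by rewrite -lee_fin -intf; apply: integral_ge0 => w _; rewrite lee_fin.
have mfZ k : measurable_fun [set: T] (fun w => f k (Z k w)).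
  exact: measurableT_comp.
(* The coordinates in [s] already carry [f], those in [t] still carry indicators: with [s] empty
   this is independence, with [t] empty it is the claim. *)
suff H (s t : seq I) (U : I -> set R) : uniq (s ++ t) ->
    (forall k, measurable (U k)) ->
    (\int[P]_w (\prod_(k <- s) f k (Z k w) *
                \prod_(k <- t) \1_(U k) (Z k w))%:E =
     (\prod_(k <- s) a k * \prod_(k <- t) fine (P (Z k @^-1` U k)))%:E)%E.
  have := H (enum A) [::] (fun=> setT).
  rewrite cats0 enum_uniq => /(_ isT (fun=> measurableT)).
  under eq_integral do rewrite big_nil mulr1 big_enum.
  by rewrite big_nil mulr1 big_enum.
elim: s t U => [|k s IH] t U.
  rewrite /= => ut mU; rewrite big_nil mul1r.
  have mI k : measurable (Z k @^-1` U k) by exact: measurable_funPTI.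
  transitivity (\int[P]_w
      (\1_(\bigcap_(k in [set k | k \in [set k in t]%SET]) Z k @^-1` U k) w)%:E)%E.
    apply: eq_integral => w _; rewrite big_nil mul1r; congr EFin.
    rewrite indicE; case: (boolP (_ \in _)) => [|].
      rewrite inE => wI; apply: big1_seq => k /andP[_ kt].
      by rewrite indicE mem_set//; apply: (wI k); rewrite /= inE.
    apply: contraNeq; rewrite prodf_seq_neq0 => /allP Ut.
    rewrite inE => k /=; rewrite inE => /Ut.
    by rewrite indicE; case: (boolP (_ \in _)) => [/set_mem//|]; rewrite eqxx.
  rewrite integral_indic//; last exact: fin_bigcap_measurable.
  rewrite setIT.
  transitivity (\prod_(k in [set k in t]%SET) P (Z k @^-1` U k))%E.
    exact: indZ.
  rewrite (eq_bigl (mem t)); last by move=> i; rewrite finset.inE.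
  rewrite -big_uniq//.
  elim: (t) => [|k t' IHt]; first by rewrite !big_nil.
  by rewrite !big_cons IHt EFinM fineK// fin_num_measure.
rewrite /= => /andP[kst ust] mU.
pose h w := \prod_(k <- s) f k (Z k w) * \prod_(k <- t) \1_(U k) (Z k w).
pose c := \prod_(k <- s) a k * \prod_(k <- t) fine (P (Z k @^-1` U k)).
transitivity (\int[P]_w (f k (Z k w) * h w)%:E)%E.
  by apply: eq_integral => w _; rewrite big_cons mulrA.
have c0 : 0 <= c.
  by rewrite mulr_ge0// prodr_ge0//= => i _; exact: fine_ge0.
transitivity (\int[P]_w (f k (Z k w) * c)%:E)%E; last first.
  under eq_integral do rewrite mulrC EFinM.
  rewrite ge0_integralZl//.
  - by rewrite intf big_cons -mulrA mulrC EFinM.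
  - exact/measurable_EFinP.
  - by move=> w _; rewrite lee_fin.
apply: ge0_integral_weighted_comp_eq => //.
- apply: measurable_funM; apply: measurable_prod => i _ //.
  by apply: measurableT_comp => //; exact: measurable_indic.
- by move=> w; rewrite mulr_ge0// prodr_ge0.
move=> V mV.
(* Sending [k] back to the indicator list with the set [V] puts the induction hypothesis to use; [k]
   is fresh, so the other sets are unchanged. *)
pose U' i := if i == k then V else U i.
have UE i : i \in s ++ t -> U' i = U i.
  by rewrite /U'; case: eqP => // ->; rewrite (negbTE kst).
have := IH (k :: t) U'; rewrite -cat1s uniq_catCA /= kst ust => /(_ isT) IHk.
have mU' i : measurable (U' i) by rewrite /U'; case: eqP.
have prodU' (F : I -> set R -> R) :
    \prod_(i <- t) F i (U' i) = \prod_(i <- t) F i (U i).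
  by apply: eq_big_seq => i it; rewrite UE// mem_cat it orbT.
transitivity (\int[P]_w (\prod_(i <- s) f i (Z i w) *
    \prod_(i <- k :: t) \1_(U' i) (Z i w))%:E)%E.
  apply: eq_integral => w _; congr EFin; rewrite /h big_cons mulrCA.
  by rewrite (prodU' (fun i V => \1_V (Z i w))) {1}/U' eqxx.
rewrite IHk// big_cons (prodU' (fun i V => fine (P (Z i @^-1` V)))).
rewrite {1}/U' eqxx mulrCA -/c EFinM fineK ?fin_num_measure//; last first.
  exact: measurable_funPTI.
under eq_integral do rewrite mulrC EFinM.
rewrite ge0_integralZl//.
- rewrite muleC; congr (_ * _)%E.
  transitivity (\int[P]_w (\1_(Z k @^-1` V) w)%:E)%E; last by [].
  by rewrite integral_indic ?setIT//; exact: measurable_funPTI.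
- by apply/measurable_EFinP; exact: measurableT_comp.
Qed.

Lemma iid_normal_exp_linear d (T : measurableType d) (R : realType)
    (P : probability T R) (I : finType) (s : R) (Z : I -> {RV P >-> R})
    (a : I -> R) : 0 < s -> iid_centered_normal s Z ->
  (\int[P]_w (expR (\sum_k a k * Z k w))%:E =
   (expR (s ^+ 2 / 2 * \sum_k a k ^+ 2))%:E)%E.
Proof.
move=> s0 [indZ lawZ].
transitivity (\int[P]_w (\prod_(k in [set: I]%SET) expR (a k * Z k w))%:E)%E.
  apply: eq_integral => w _; rewrite expR_sum; congr EFin.
  by apply: eq_bigl => k; rewrite finset.inE.
rewrite (@independent_integral_prod _ _ _ _ _ Z (fun k x => expR (a k * x))
    (fun k => expR (s ^+ 2 * a k ^+ 2 / 2)) [set: I]%SET indZ)//.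
- rewrite mulr_sumr expR_sum; congr EFin; apply: eq_big => k.
    by rewrite finset.inE.
  by move=> _; rewrite mulrAC.
- by move=> k; apply: measurableT_comp => //; exact: measurable_funM.
- by move=> k; exact: (integral_normal_law_exp_linear _ s0 (lawZ k)).
Qed.

Lemma iid_normal_exp_square d (T : measurableType d) (R : realType)
    (P : probability T R) (I : finType) (s : R) (Z : I -> {RV P >-> R})
    (A : {set I}) : 0 < s -> iid_centered_normal s Z ->
  (\int[P]_w (expR ((\sum_(k in A) Z k w ^+ 2) / (4 * s ^+ 2)))%:E =
   (Num.sqrt 2 ^+ #|A|)%:E)%E.
Proof.
move=> s0 [indZ lawZ].
transitivity
    (\int[P]_w (\prod_(k in A) expR (Z k w ^+ 2 / (4 * s ^+ 2)))%:E)%E.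
  by apply: eq_integral => w _; rewrite mulr_suml expR_sum.
rewrite (@independent_integral_prod _ _ _ _ _ Z
    (fun k x => expR (x ^+ 2 / (4 * s ^+ 2))) (fun=> Num.sqrt 2) A indZ)//.
- by rewrite prodr_const.
- by move=> k; apply: measurableT_comp => //; exact: measurable_funM.
- by move=> k; exact: (integral_normal_law_exp_square s0 (lawZ k)).
Qed.

(** * Frobenius inner product and partial isometries *)

Definition mxdot (R : comNzRingType) n m (A B : 'M[R]_(n, m)) : R := \tr (A^T *m B).

Lemma mxdotE (R : comNzRingType) n m (A B : 'M[R]_(n, m)) :
  mxdot A B = \sum_i \sum_j A i j * B i j.
Proof.
rewrite /mxdot exchange_big; apply: eq_bigr => j _.
by rewrite mxE; apply: eq_bigr => i _; rewrite mxE.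
Qed.

Lemma mxdotC (R : comNzRingType) n m (A B : 'M[R]_(n, m)) : mxdot A B = mxdot B A.
Proof. by rewrite /mxdot -mxtrace_tr trmx_mul trmxK. Qed.

Lemma mxdotDl (R : comNzRingType) n m (A B C : 'M[R]_(n, m)) :
  mxdot (A + B) C = mxdot A C + mxdot B C.
Proof. by rewrite /mxdot linearD mulmxDl linearD. Qed.

Lemma mxdotDr (R : comNzRingType) n m (A B C : 'M[R]_(n, m)) :
  mxdot A (B + C) = mxdot A B + mxdot A C.
Proof. by rewrite /mxdot mulmxDr linearD. Qed.

Lemma mxdotNl (R : comNzRingType) n m (A C : 'M[R]_(n, m)) :
  mxdot (- A) C = - mxdot A C.
Proof. by rewrite /mxdot linearN mulNmx linearN. Qed.

Lemma mxdotNr (R : comNzRingType) n m (A C : 'M[R]_(n, m)) :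
  mxdot A (- C) = - mxdot A C.
Proof. by rewrite mxdotC mxdotNl mxdotC. Qed.

Lemma mxdotZl (R : comNzRingType) n m a (A C : 'M[R]_(n, m)) :
  mxdot (a *: A) C = a * mxdot A C.
Proof. by rewrite /mxdot linearZ -scalemxAl linearZ. Qed.

Lemma mxdotZr (R : comNzRingType) n m a (A C : 'M[R]_(n, m)) :
  mxdot A (a *: C) = a * mxdot A C.
Proof. by rewrite mxdotC mxdotZl mxdotC. Qed.

Lemma mxdot_mull (R : comNzRingType) n m p (Q : 'M[R]_(n, p)) (A : 'M[R]_(p, m))
  (B : 'M[R]_(n, m)) : mxdot (Q *m A) B = mxdot A (Q^T *m B).
Proof. by rewrite /mxdot trmx_mul mulmxA. Qed.

Lemma mxdot_tr (R : comNzRingType) n m (A B : 'M[R]_(n, m)) :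
  mxdot A^T B^T = mxdot A B.
Proof. by rewrite /mxdot trmxK mxtrace_mulC -mxtrace_tr trmx_mul trmxK. Qed.

Lemma mxdot_ge0 (R : realDomainType) n m (A : 'M[R]_(n, m)) : 0 <= mxdot A A.
Proof.
by rewrite mxdotE; do 2 apply: sumr_ge0 => ? _; rewrite -expr2 sqr_ge0.
Qed.

Lemma mxdot_eq0 (R : realDomainType) n m (A : 'M[R]_(n, m)) :
  mxdot A A = 0 -> A = 0.
Proof.
rewrite mxdotE => A0; apply/matrixP => i j; rewrite mxE.
have s0 k : 0 <= \sum_l A k l * A k l.
  by apply: sumr_ge0 => l _; rewrite -expr2 sqr_ge0.
have /eqP := psumr_eq0P (fun k _ => s0 k) A0 (i := i) isT.
rewrite psumr_eq0; last by move=> l _; rewrite -expr2 sqr_ge0.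
by move=> /allP/(_ j); rewrite mem_index_enum /= mulf_eq0 orbb => /(_ isT)/eqP.
Qed.

Lemma frob_sqr (R : realType) n m (A : 'M[R]_(n, m)) : frob A ^+ 2 = mxdot A A.
Proof.
rewrite /frob sqr_sqrtr ?mxdotE; last by do 2 apply: sumr_ge0 => ? _; exact: sqr_ge0.
by do 2 apply: eq_bigr => ? _; rewrite expr2.
Qed.

Lemma frob_ge0 (R : realType) n m (A : 'M[R]_(n, m)) : 0 <= frob A.
Proof. exact: sqrtr_ge0. Qed.

Lemma mxdot_CS (R : realType) n m (A B : 'M[R]_(n, m)) :
  mxdot A B <= frob A * frob B.
Proof.
have := mxdot_ge0 (frob B *: A - frob A *: B).
rewrite !(mxdotDl, mxdotDr, mxdotNl, mxdotNr, mxdotZl, mxdotZr) (mxdotC B A).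
rewrite -!frob_sqr => H.
have [A0|A0] := eqVneq (frob A) 0.
  have -> : A = 0 by apply: mxdot_eq0; rewrite -frob_sqr A0 expr0n.
  by rewrite /mxdot trmx0 mul0mx mxtrace0 mulr_ge0// frob_ge0.
have [B0|B0] := eqVneq (frob B) 0.
  have -> : B = 0 by apply: mxdot_eq0; rewrite -frob_sqr B0 expr0n.
  by rewrite /mxdot mulmx0 mxtrace0 mulr_ge0// frob_ge0.
have AB : 0 < frob A * frob B by rewrite mulr_gt0// lt0r ?A0 ?B0 frob_ge0.
rewrite -(ler_pM2l AB); lra.
Qed.

Lemma orthogonal_projection_contract (R : realType) n m (Q : 'M[R]_n)
    (M : 'M[R]_(n, m)) : orthogonal_projection Q ->
  mxdot (Q *m M) (Q *m M) <= mxdot M M.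
Proof.
move=> [QT QQ]; rewrite mxdot_mull QT mulmxA QQ.
have := mxdot_ge0 ((1%:M - Q) *m M).
rewrite mxdot_mull linearB /= trmx1 QT mulmxA mulmxBl mul1mx mulmxBr mulmx1 QQ.
by rewrite subrr subr0 mulmxBl mul1mx mxdotDr mxdotNr subr_ge0.
Qed.

Lemma orthogonal_projectionC (R : realType) n (Q : 'M[R]_n) :
  orthogonal_projection Q -> orthogonal_projection (1%:M - Q).
Proof.
move=> [QT QQ]; split; first by rewrite linearB /= trmx1 QT.
by rewrite mulmxBl mul1mx mulmxBr mulmx1 QQ subrr subr0.
Qed.

(* The condition [Q *m Q^T *m Q = Q] says that [Q] is a partial isometry, i.e.,
   its columns are orthonormal up to some null columns. *)
Lemma partial_isometry_col_basis (R : realType) n p k (A : 'M[R]_(n, p)) :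
  (\rank A <= k)%N ->
  exists Q : 'M[R]_(n, k),
    [/\ Q *m Q^T *m A = A, Q *m Q^T *m Q = Q & colspace_sub Q A].
Proof.
elim: k A => [|k IH] A rA.
  exists 0; rewrite !mul0mx /colspace_sub trmx0 sub0mx; split => //.
  by apply/esym/eqP; rewrite -mxrank_eq0 -leqn0.
have [->|A0] := eqVneq A 0.
  by exists 0; rewrite !mul0mx /colspace_sub trmx0 sub0mx; split.
have [j aj] : exists j, col j A != 0.
  apply/existsP; move: A0; apply: contraNT; rewrite negb_exists => /forallP H.
  apply/eqP/matrixP => i j; rewrite mxE.
  by have /negPn/eqP/matrixP/(_ i 0) := H j; rewrite !mxE.
set a := col j A in aj.
have a0 : 0 < frob a.
  rewrite lt0r frob_ge0 andbT; apply: contraNneq aj => a0.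
  by rewrite (@mxdot_eq0 _ _ _ a)// -frob_sqr a0 expr0n.
pose u := (frob a)^-1 *: a.
have uu : u^T *m u = 1%:M.
  rewrite [LHS]mx11_scalar; congr (_%:M); rewrite -trace_mx11 -/(mxdot u u).
  by rewrite mxdotZl mxdotZr -frob_sqr; field; rewrite gt_eqF.
have uA : (u^T <= A^T)%MS.
  by rewrite linearZ /= scalemx_sub// /a tr_col row_sub.
(* A Gram-Schmidt step: the direction [u] of a nonzero column is removed, and the induction
   hypothesis is applied to the rest. *)
pose A' := A - u *m u^T *m A.
have uA' : u^T *m A' = 0.
  by rewrite mulmxBr -mulmxA [u^T *m (u *m _)]mulmxA uu mul1mx subrr.
have A'A : (A'^T <= A^T)%MS.
  rewrite linearB /= addmx_sub// -scaleN1r scalemx_sub// -mulmxA trmx_mul.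
  by rewrite (submx_trans _ uA)// submxMl.
(* If the rank did not drop, [u] would lie in the column space of [A'], to which it is
   orthogonal. *)
have rA' : (\rank A' <= k)%N.
  rewrite -ltnS (leq_trans _ rA)// -[X in (X < _)%N]mxrank_tr -[X in (_ < X)%N]mxrank_tr.
  rewrite ltnNge; apply/negP => rAA'.
  have AA' : (A^T <= A'^T)%MS by rewrite -(mxrank_leqif_sup A'A) eqn_leq mxrankS.
  have /submxP[D uD] := submx_trans uA AA'.
  have : u^T *m u = 0.
    by rewrite {2}(_ : u = A' *m D^T) ?mulmxA ?uA' ?mul0mx// -[LHS]trmxK uD trmx_mul trmxK.
  by rewrite uu => /matrixP/(_ 0 0)/eqP; rewrite !mxE /= oner_eq0.
have [Q [QA QQ Qsub]] := IH A' rA'.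
have uQ : u^T *m Q = 0.
  have /submxP[D QD] := Qsub.
  by rewrite (_ : Q = A' *m D^T) ?mulmxA ?uA' ?mul0mx// -[LHS]trmxK QD trmx_mul trmxK.
have Qu : Q^T *m u = 0 by rewrite -[LHS]trmxK trmx_mul trmxK uQ trmx0.
suff [Q' Q'P] : exists Q' : 'M[R]_(n, 1 + k),
    [/\ Q' *m Q'^T *m A = A, Q' *m Q'^T *m Q' = Q' & colspace_sub Q' A].
  by exists Q'.
exists (row_mx u Q); rewrite tr_row_mx mul_row_col; split.
- rewrite mulmxDl; have -> : Q *m Q^T *m A = A'; last by rewrite /A' addrC subrK.
  have {1}-> : A = A' + u *m (u^T *m A) by rewrite /A' -mulmxA subrK.
  by rewrite mulmxDr QA -mulmxA [Q^T *m (u *m _)]mulmxA Qu mul0mx mulmx0 addr0.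
- by rewrite mul_mx_row !mulmxDl QQ -!mulmxA uu uQ Qu !mulmx0 mulmx1 addr0 add0r.
- rewrite /colspace_sub tr_row_mx col_mx_sub uA /=.
  exact: submx_trans A'A.
Qed.

Lemma partial_isometry_projection (R : realType) n k (Q : 'M[R]_(n, k)) :
  Q *m Q^T *m Q = Q -> orthogonal_projection (Q *m Q^T).
Proof. by move=> QQ; split; rewrite ?trmx_mul ?trmxK// mulmxA QQ. Qed.

Lemma partial_isometry_tr (R : realType) n k (Q : 'M[R]_(n, k)) :
  Q *m Q^T *m Q = Q -> Q^T *m Q^T^T *m Q^T = Q^T.
Proof. by move=> QQ; rewrite -mulmxA -!trmx_mul QQ. Qed.

(** The transpose is a partial isometry too, so [Q^T *m Q] is an orthogonal projection, and the norm
    of [Q *m M] is that of the projection of [M]. *)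
Lemma partial_isometry_contract (R : realType) n k m (Q : 'M[R]_(n, k))
    (M : 'M[R]_(k, m)) : Q *m Q^T *m Q = Q ->
  mxdot (Q *m M) (Q *m M) <= mxdot M M.
Proof.
move=> /partial_isometry_tr/partial_isometry_projection; rewrite trmxK => QQ.
apply: le_trans (orthogonal_projection_contract M QQ).
by rewrite [leRHS]mxdot_mull QQ.1 [X in _ <= mxdot _ X]mulmxA QQ.2 mxdot_mull mulmxA.
Qed.

Lemma partial_isometry_frob (R : realType) n k (Q : 'M[R]_(n, k)) :
  Q *m Q^T *m Q = Q -> mxdot Q Q <= k%:R.
Proof.
move=> /(@partial_isometry_contract _ _ _ _ Q 1%:M); rewrite mulmx1 => H.
by apply: le_trans H _; rewrite /mxdot trmx1 mulmx1 mxtrace1.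
Qed.

(** * A lattice net for matrices of bounded rank *)

(** This is the second-order coefficient of the squared norm of [V *m W^T] when the single entry
    [(i, l)] of [V] moves; it does not depend on [V]. *)
Lemma mxdot_delta_mul (R : comNzRingType) q k m (i : 'I_q) (l : 'I_k)
    (W : 'M[R]_(m, k)) :
  mxdot (delta_mx i l *m W^T) (delta_mx i l *m W^T) = \sum_j W j l ^+ 2.
Proof.
have E a b : (delta_mx i l *m W^T) a b = (a == i)%:R * W b l.
  rewrite mxE (bigD1 l)//= big1 ?addr0 => [|c cl]; first by rewrite !mxE eqxx andbT.
  by rewrite !mxE (negPf cl) andbF mul0r.
rewrite mxdotE (bigD1 i)//= [X in _ + X]big1 ?addr0 => [|a ai].
  by apply: eq_bigr => j _; rewrite !E eqxx mul1r expr2.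
by rewrite big1// => j _; rewrite !E (negPf ai) !mul0r.
Qed.

(* Each entry can be rounded up or down; since the objective is concave and
   quadratic in a single entry, going in the direction of the slope loses at
   most the second-order term. *)
Lemma lattice_rounding (R : realType) q k m (G : 'M[R]_(q, m))
    (U : 'M[R]_(q, k)) (W : 'M[R]_(m, k)) (kap del : R) :
    0 <= kap -> 0 < del ->
    let F V := mxdot G (V *m W^T) - kap * mxdot (V *m W^T) (V *m W^T) in
  exists U' : 'M[R]_(q, k),
    [/\ forall i l, exists z : int, U' i l = del * z%:~R,
        forall i l, `|U' i l - U i l| <= del &
        F U - kap * del ^+ 2 * q%:R * mxdot W W <= F U'].
Proof.
move=> kap0 del0 F.
pose w l := \sum_j W j l ^+ 2.
have w0 l : 0 <= w l by apply: sumr_ge0 => j _; exact: sqr_ge0.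
have Fstep V i l x : F (V + x *: delta_mx i l) = F V
    + x * (mxdot G (delta_mx i l *m W^T)
           - 2 * kap * mxdot (V *m W^T) (delta_mx i l *m W^T))
    - kap * x ^+ 2 * w l.
  rewrite /F mulmxDl -scalemxAl !(mxdotDl, mxdotDr, mxdotZl, mxdotZr).
  rewrite mxdot_delta_mul -/(w l) (mxdotC (delta_mx i l *m W^T) (V *m W^T)).
  by ring.
(* Entries are rounded one at a time. Those outside [s] still agree with [U], so each entry moves
   once, by at most [del]. *)
have key (s : seq ('I_q * 'I_k)) : uniq s -> exists U' : 'M[R]_(q, k),
    [/\ forall i l, (i, l) \in s -> exists z : int, U' i l = del * z%:~R,
        forall i l, (i, l) \notin s -> U' i l = U i l,
        forall i l, `|U' i l - U i l| <= del &
        F U - kap * del ^+ 2 * (\sum_(a <- s) w a.2) <= F U'].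
  elim: s => [_|[i l] s IH /= /andP[ils us]].
    exists U; split => // [i l|]; first by rewrite subrr normr0 ltW.
    by rewrite big_nil mulr0 subr0.
  have [V [Vs Vn Vd VF]] := IH us.
  set b := mxdot G (delta_mx i l *m W^T)
           - 2 * kap * mxdot (V *m W^T) (delta_mx i l *m W^T) in Fstep *.
  have [x [z xz] [xdel xb]] : exists2 x : R,
      exists z : int, U i l + x = del * z%:~R & `|x| <= del /\ 0 <= x * b.
    pose y := U i l / del; pose z := Num.floor y.
    have yz : z%:~R <= y by exact: floor_le.
    have yz1 : y < (z + 1)%:~R by exact: floorD1_gt.
    have Uy : U i l = del * y by rewrite /y mulrC divfK// gt_eqF.
    rewrite intrD in yz1.
    have [b0|b0] := leP 0 b.
      exists (del * (z + 1)%:~R - U i l); first by exists (z + 1); rewrite addrC subrK.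
      rewrite Uy -mulrBr intrD; have : 0 <= z%:~R + 1 - y by lra.
      have : z%:~R + 1 - y <= 1 by lra.
      move=> h1 h2; split; last by rewrite mulr_ge0// mulr_ge0// ltW.
      by rewrite normrM !ger0_norm ?(ltW del0)// ler_piMr// ltW.
    exists (del * z%:~R - U i l); first by exists z; rewrite addrC subrK.
    rewrite Uy -mulrBr; have : z%:~R - y <= 0 by lra.
    have : - 1 <= z%:~R - y by lra.
    move=> h1 h2; split; last first.
      by rewrite mulr_le0 ?(ltW b0)// mulr_ge0_le0// ltW.
    by rewrite normrM ger0_norm ?(ltW del0)// ler0_norm// ler_piMr ?(ltW del0)//; lra.
  have V' a c : (V + x *: delta_mx i l) a c =
      if (a, c) == (i, l) then U i l + x else V a c.
    rewrite !mxE xpair_eqE; case: eqP => [->|_]; last by rewrite mulr0 addr0.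
    by case: eqP => [->|_]; rewrite ?mulr1 ?mulr0 ?addr0// Vn.
  exists (V + x *: delta_mx i l); split => [a c|a c|a c|].
  - rewrite inE V'; case: eqP => [_ _|_ /=]; last exact: Vs.
    by exists z.
  - by rewrite inE V' negb_or; case: eqP => //= _; exact: Vn.
  - by rewrite V'; case: eqP => [[-> ->]|_//]; rewrite addrC addKr.
  - rewrite Fstep -/b big_cons /=.
    have : kap * x ^+ 2 * w l <= kap * del ^+ 2 * w l.
      rewrite ler_wpM2r// ler_wpM2l// -(ger0_norm (sqr_ge0 x)) normrX.
      by rewrite lerXn2r ?nnegrE// ltW.
    by move: VF xb; lra.
have [U' [Us _ Ud UF]] := key _ (enum_uniq [set: 'I_q * 'I_k]%SET).
exists U'; split => // [i l|]; first by apply: Us; rewrite mem_enum finset.inE.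
apply: le_trans UF; rewrite lerD2l lerN2 -[leRHS]mulrA ler_wpM2l//.
  by rewrite mulr_ge0// sqr_ge0.
rewrite big_enum /= (eq_bigl predT); last by move=> a; rewrite finset.inE.
rewrite -(pair_bigA _ (fun _ l => w l)) /= sumr_const card_ord -[leLHS]mulr_natl.
by rewrite mxdotE exchange_big /= /w ler_wpM2l// ler_sum.
Qed.

Lemma geometric_half_le (R : realFieldType) M : \sum_(a < M) (1 / 2) ^+ a <= 2 :> R.
Proof.
suff -> : \sum_(a < M) (1 / 2) ^+ a = 2 - 2 * (1 / 2) ^+ M :> R.
  by rewrite gerBl mulr_ge0// exprn_ge0// divr_ge0.
elim: M => [|M IH]; first by rewrite big_ord0 expr0; ring.
by rewrite big_ord_recr /= IH exprS; field.
Qed.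

(* Chernoff-style counting: each admissible [f] has weight
   [2 ^ N * \prod_x 2 ^ - |f x| >= 1]. *)
Lemma card_lattice_ball (R : realFieldType) (I : finType) (M N : nat) :
  #|[set f : {ffun I -> bool * 'I_M} | (\sum_x (f x).2 <= N)%N]%SET|%:R
    <= 2 ^+ N * 4 ^+ #|I| :> R.
Proof.
have E : \sum_(f : {ffun I -> bool * 'I_M}) \prod_x (1 / 2) ^+ (f x).2
    <= 4 ^+ #|I| :> R.
  rewrite -(bigA_distr_bigA (fun _ (y : bool * 'I_M) => (1 / 2) ^+ y.2)) /=.
  rewrite prodr_const lerXn2r ?nnegrE//.
    by apply: sumr_ge0 => y _; rewrite exprn_ge0// divr_ge0.
  rewrite -(pair_bigA _ (fun _ (a : 'I_M) => (1 / 2) ^+ a)) /= big_bool /=.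
  by have := geometric_half_le R M; lra.
apply: le_trans (ler_wpM2l _ E); last by rewrite exprn_ge0.
rewrite -sum1_card natr_sum mulr_sumr big_mkcond /=; apply: ler_sum => f _.
rewrite finset.inE prodrXr; case: ifPn => fN.
  rewrite div1r exprVn ler_pdivlMr ?exprn_gt0// mul1r.
  by rewrite ler_weXn2l// ler1n.
by rewrite mulr_ge0// exprn_ge0// divr_ge0.
Qed.

(** Sign and absolute value are stored apart, so that the sum of the absolute values of the entries
    is the quantity bounded in [card_lattice_ball]. Zero has two codes, which is harmless for an
    upper count. *)
Definition lattice_mx (R : realFieldType) q k M
    (f : {ffun 'I_q * 'I_k -> bool * 'I_M}) : 'M[R]_(q, k) :=
  \matrix_(i, l) ((-1) ^+ (f (i, l)).1 * (f (i, l)).2%:R).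

(** An integer is at most its square in absolute value, so the squared Frobenius norm bounds the sum
    of the absolute values. *)
Lemma lattice_mx_surj (R : realType) q k N (V : 'M[R]_(q, k)) :
    (forall i l, exists z : int, V i l = z%:~R) -> mxdot V V <= N%:R ->
  exists2 f : {ffun 'I_q * 'I_k -> bool * 'I_N.+1},
    (\sum_x (f x).2 <= N)%N & V = lattice_mx R f.
Proof.
move=> Vz VN; pose z i l := Num.floor (V i l).
have VE i l : V i l = (z i l)%:~R.
  by rewrite /z; have [y ->] := Vz i l; rewrite intrKfloor.
have zN : (\sum_(x : 'I_q * 'I_k) `|z x.1 x.2|%N <= N)%N.
  rewrite -(ler_nat R); apply: le_trans VN; rewrite natr_sum mxdotE pair_bigA /=.
  apply: ler_sum => -[i l] _ /=; rewrite VE natr_absz -intrM ler_int.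
  rewrite -expr2 -real_normK ?num_real// expr2 -abszE.
  by case: `|z i l|%N => // a; rewrite -[leLHS]mul1r ler_pM2r.
have zl x : (`|z x.1 x.2| < N.+1)%N.
  by rewrite ltnS (leq_trans _ zN)// (bigD1 x)//= leq_addr.
exists [ffun x => (z x.1 x.2 < 0, inord `|z x.1 x.2|%N)].
  apply: leq_trans zN; apply: leq_sum => x _; rewrite ffunE /= inordK//.
apply/matrixP => i l; rewrite mxE ffunE /= inordK ?(zl (i, l))// VE.
by rewrite {1}[z i l]intEsign rmorphM rmorphXn rmorphN1.
Qed.

Lemma mxdot_le_sum2 (R : realDomainType) n m (A B : 'M[R]_(n, m)) :
  mxdot A A <= 2 * mxdot B B + 2 * mxdot (A - B) (A - B).
Proof.
have := mxdot_ge0 (2 *: B - A).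
rewrite !(mxdotDl, mxdotDr, mxdotNl, mxdotNr, mxdotZl, mxdotZr) (mxdotC B A).
by lra.
Qed.

Lemma mxdot_le_entries (R : realDomainType) n m (A : 'M[R]_(n, m)) (e : R) :
  (forall i j, `|A i j| <= e) -> mxdot A A <= (n * m)%:R * e ^+ 2.
Proof.
move=> Ae; rewrite mxdotE natrM -mulrA.
rewrite -[n in n%:R]card_ord mulr_natl -sumr_const; apply: ler_sum => i _.
rewrite -[m in m%:R]card_ord mulr_natl -sumr_const; apply: ler_sum => j _.
by rewrite -expr2 -real_normK ?num_real// lerXn2r ?nnegrE// (le_trans _ (Ae i j)).
Qed.

(** The two factors are rounded in turn for the objective [mxdot G D] minus [Z / 8] times the
    squared norm of [D]. The quadratic term is kept in the conclusion because [D] is not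
    normalized. *)
Lemma lattice_approx_lowrank (R : realType) q k m (U : 'M[R]_(q, k))
    (W : 'M[R]_(m, k)) (G : 'M[R]_(q, m)) :
    mxdot U U <= k%:R -> mxdot W W <= 1 ->
    mxdot (U *m W^T) (U *m W^T) <= 1 -> 0 < mxdot G (U *m W^T) ->
  exists (f : {ffun 'I_q * 'I_k -> bool * 'I_(4 * (q * k)).+1})
         (g : {ffun 'I_m * 'I_k -> bool * 'I_(4 * (m * k)).+1}) (c : R),
    [/\ (\sum_x (f x).2 <= 4 * (q * k))%N, (\sum_x (g x).2 <= 4 * (m * k))%N,
        0 < c &
        let D := c *: (lattice_mx R f *m (lattice_mx R g)^T) in
        mxdot G (U *m W^T) * (1 / 4 + mxdot D D / 8) <= mxdot G D].
Proof.
set Z := mxdot G _ => Uk W1 UW1 Z0.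
have [q0 m0 k0] : [/\ (0 < q)%N, (0 < m)%N & (0 < k)%N].
  rewrite !lt0n; split; apply: contraTneq Z0 => z0; rewrite -leNgt /Z.
  - by rewrite mxdotE big1// => -[i iz]; exfalso; rewrite z0 in iz.
  - by rewrite mxdotE big1// => i _; rewrite big1// => -[j iz]; exfalso; rewrite z0 in iz.
  - rewrite mxdotE big1// => i _; rewrite big1// => j _.
    by rewrite mxE big1 ?mulr0// => -[l iz]; exfalso; rewrite z0 in iz.
have qk0 : 0 < (q%:R : R) by rewrite ltr0n.
(* Meshes for which rounding moves [U] by at most [k] and [W] by at most 1 in squared norm, while
   the rescaled factors have squared norms at most [4 * (q * k)] and [4 * (m * k)]. *)
pose du : R := Num.sqrt (q%:R^-1); pose dw : R := Num.sqrt ((m * k)%:R^-1).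
have du0 : 0 < du by rewrite sqrtr_gt0 invr_gt0 ltr0n.
have dw0 : 0 < dw by rewrite sqrtr_gt0 invr_gt0 ltr0n muln_gt0 m0.
have du2 : du ^+ 2 = q%:R^-1 by rewrite sqr_sqrtr// invr_ge0.
have dw2 : dw ^+ 2 = (m * k)%:R^-1 by rewrite sqr_sqrtr// invr_ge0.
have kap0 : 0 <= Z / 8 by rewrite divr_ge0// ltW.
have [U' [U'z U'd]] := lattice_rounding G U W kap0 du0; rewrite -/Z => U'F.
have UU' : mxdot U' U' <= 4 * k%:R.
  have := mxdot_le_entries (A := U' - U) (e := du).
  rewrite du2 natrM mulrAC divff ?gt_eqF// mul1r => H.
  have := mxdot_le_sum2 U' U.
  have : mxdot (U' - U) (U' - U) <= k%:R by apply: H => i j; rewrite !mxE.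
  by lra.
(* Transposition makes [W] the left factor, with the rounded [U'] now fixed. *)
have [W' [W'z W'd]] := lattice_rounding G^T W U' kap0 dw0.
have trE V : V *m U'^T = (U' *m V^T)^T by rewrite trmx_mul trmxK.
rewrite !trE !mxdot_tr => W'F.
have WW' : mxdot W' W' <= 4.
  have := mxdot_le_entries (A := W' - W) (e := dw).
  rewrite dw2 divff; last by rewrite gt_eqF// ltr0n muln_gt0 m0.
  move=> H; have := mxdot_le_sum2 W' W.
  have : mxdot (W' - W) (W' - W) <= 1 by apply: H => i j; rewrite !mxE.
  by lra.
have [f fN fE] : exists2 f : {ffun 'I_q * 'I_k -> bool * 'I_(4 * (q * k)).+1},
    (\sum_x (f x).2 <= 4 * (q * k))%N & du^-1 *: U' = lattice_mx R f.
  apply: lattice_mx_surj => [i l|].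
    by have [z Uz] := U'z i l; exists z; rewrite mxE Uz mulKf// gt_eqF.
  rewrite mxdotZl mxdotZr mulrA -expr2 exprVn du2 invrK mulnCA natrM.
  by rewrite ler_pM2l// natrM.
have [g gN gE] : exists2 g : {ffun 'I_m * 'I_k -> bool * 'I_(4 * (m * k)).+1},
    (\sum_x (g x).2 <= 4 * (m * k))%N & dw^-1 *: W' = lattice_mx R g.
  apply: lattice_mx_surj => [i l|].
    by have [z Wz] := W'z i l; exists z; rewrite mxE Wz mulKf// gt_eqF.
  rewrite mxdotZl mxdotZr mulrA -expr2 exprVn dw2 invrK (natrM _ 4) [leRHS]mulrC.
  by rewrite ler_wpM2l.
exists f, g, (du * dw); split => //; first exact: mulr_gt0.
rewrite -fE -gE linearZ /= -scalemxAl -scalemxAr !scalerA.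
rewrite (_ : du * dw * du^-1 * dw^-1 = 1); last by field; rewrite !gt_eqF.
rewrite scale1r; move: U'F W'F => /=.
have -> : Z / 8 * du ^+ 2 * q%:R = Z / 8 by rewrite du2; field; rewrite gt_eqF.
have -> : Z / 8 * dw ^+ 2 * m%:R = Z / 8 * k%:R^-1.
  by rewrite dw2 natrM; field; rewrite !pnatr_eq0 -!lt0n k0.
have UU4 : k%:R^-1 * mxdot U' U' <= 4 by rewrite ler_pdivrMl ?ltr0n// mulrC.
(* The initial quadratic term costs at most [Z / 8], rounding [U] another [Z / 8] and rounding [W]
   at most [Z / 2], so at least [Z / 4] remains. *)
have := ler_wpM2l kap0 UW1; have := ler_wpM2l kap0 W1; have := ler_wpM2l kap0 UU4.
rewrite -/Z; set a := mxdot _ _; set b := mxdot (U *m _) _; set c := mxdot G _.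
set d := mxdot (U' *m _) _; set e := mxdot W W; set h := mxdot G _.
by lra.
Qed.

(** The net consists of normalized products of lattice matrices: the scale [c] drops out and only
    integer matrices are counted. A basis [Q] of the column space of [X] replaces the [n] rows by
    [q] coordinates. *)
Lemma rank_ball_net (R : realType) n p m q k (X : 'M[R]_(n, p)) :
    (\rank X <= q)%N ->
  exists (I : finType) (D : I -> 'M[R]_(n, m)),
    [/\ #|I|%:R <= 64 ^+ (k * (q + m)) :> R,
        forall i, mxdot (D i) (D i) <= 1 &
        forall G (B : 'M[R]_(p, m)), (\rank B <= k)%N -> exists i,
          0 <= mxdot G (D i) /\
          mxdot G (X *m B) <= 4 * frob (X *m B) * mxdot G (D i)].
Proof.
move=> rX; have [Q [QX QQ _]] := partial_isometry_col_basis rX.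
pose U_ := [set f : {ffun 'I_q * 'I_k -> bool * 'I_(4 * (q * k)).+1} |
  (\sum_x (f x).2 <= 4 * (q * k))%N]%SET.
pose W_ := [set f : {ffun 'I_m * 'I_k -> bool * 'I_(4 * (m * k)).+1} |
  (\sum_x (f x).2 <= 4 * (m * k))%N]%SET.
pose D0 (fg : {ffun 'I_q * 'I_k -> bool * 'I_(4 * (q * k)).+1} *
    {ffun 'I_m * 'I_k -> bool * 'I_(4 * (m * k)).+1}) :=
  Q *m (lattice_mx R fg.1 *m (lattice_mx R fg.2)^T).
pose D fg := (frob (D0 fg))^-1 *: D0 fg.
have D1 fg : mxdot (D fg) (D fg) <= 1.
  rewrite /D mxdotZl mxdotZr -frob_sqr.
  have [->|f0] := eqVneq (frob (D0 fg)) 0; first by rewrite invr0 mul0r.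
  by rewrite (_ : _ * _ = 1)//; field.
have Dnet G (B : 'M[R]_(p, m)) : (\rank B <= k)%N -> exists2 fg,
    fg \in finset.setX U_ W_ & 0 <= mxdot G (D fg) /\
      mxdot G (X *m B) <= 4 * frob (X *m B) * mxdot G (D fg).
  move=> rB; have [Z0|Z0] := leP (mxdot G (X *m B)) 0.
    exists ([ffun=> (false, ord0)], [ffun=> (false, ord0)]).
      rewrite finset.inE /= !finset.inE.
      by rewrite !big1// => x _; rewrite ffunE.
    rewrite (_ : D _ = 0); first by rewrite /mxdot mulmx0 mxtrace0 mulr0; split.
    rewrite /D /D0 (_ : lattice_mx R _ = 0) ?mul0mx ?mulmx0 ?scaler0//.
    by apply/matrixP => a b; rewrite !mxE ffunE mulr0.
  set Z := mxdot G _ in Z0 *; set t := frob _.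
  have t0 : 0 < t.
    rewrite lt0r frob_ge0 andbT; apply: contraTneq Z0 => t0; rewrite -leNgt.
    by rewrite (le_trans (mxdot_CS _ _))// -/t t0 mulr0.
  pose N := t^-1 *: (X *m B); pose M := Q^T *m N.
  have QM : Q *m M = N by rewrite mulmxA /N -scalemxAr mulmxA QX.
  have N1 : mxdot N N = 1.
    by rewrite mxdotZl mxdotZr -frob_sqr -/t; field; rewrite gt_eqF.
  have M1 : mxdot M M <= 1.
    by rewrite -N1; apply: partial_isometry_contract; exact: partial_isometry_tr.
  have rM : (\rank M <= k)%N.
    by rewrite (leq_trans (mxrankM_maxr _ _))// (leq_trans (mxrank_scale _ _))//
      (leq_trans (mxrankM_maxr _ _)).
  (* [M] factors as [V *m (M^T *m V)^T], where [V] has squared norm at most [k] and the other factor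
     at most 1. *)
  have [V [VM VV _]] := partial_isometry_col_basis rM.
  have VWM : V *m (M^T *m V)^T = M by rewrite trmx_mul trmxK mulmxA VM.
  have GM : mxdot (Q^T *m G) M = Z / t.
    by rewrite mxdotC mxdotC mxdot_mull trmxK QM mxdotZr mulrC.
  have := @lattice_approx_lowrank _ _ _ _ V (M^T *m V) (Q^T *m G).
  rewrite VWM GM divr_gt0// => /(_ (partial_isometry_frob VV) _ M1 isT).
  case.
    rewrite -mxdot_tr trmx_mul trmxK (le_trans _ M1)//.
    by apply: partial_isometry_contract; exact: partial_isometry_tr.
  move=> f [g [c [fU gW c0 /=]]]; set L := lattice_mx R f *m _ => H.
  have DE : D0 (f, g) = Q *m L by [].
  set s := frob (D0 (f, g)).
  have cs : (c * s) ^+ 2 <= mxdot (c *: L) (c *: L).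
    rewrite exprMn frob_sqr mxdotZl mxdotZr mulrA -expr2 ler_wpM2l ?sqr_ge0//.
    exact: partial_isometry_contract.
  have GD : mxdot (Q^T *m G) (c *: L) = c * mxdot G (D0 (f, g)).
    by rewrite mxdotZr mxdot_mull trmxK.
  rewrite GD in H.
  have {}H : Z / t * (1 / 4 + (c * s) ^+ 2 / 8) <= c * mxdot G (D0 (f, g)).
    apply: le_trans H; rewrite (ler_wpM2l (ltW (divr_gt0 Z0 t0)))// lerD2l.
    by rewrite ler_wpM2r.
  have G0 : 0 < mxdot G (D0 (f, g)).
    rewrite -(pmulr_rgt0 _ c0) (lt_le_trans _ H)// mulr_gt0 ?divr_gt0//.
    by rewrite ltr_wpDr ?divr_ge0 ?sqr_ge0// divr_gt0.
  have s0 : 0 < s.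
    rewrite lt0r frob_ge0 andbT; apply: contraTneq G0 => s0; rewrite -leNgt.
    by rewrite (le_trans (mxdot_CS _ _))// -/s s0 mulr0.
  exists (f, g); first by rewrite finset.inE /= !finset.inE fU gW.
  rewrite mxdotZr -/s; split; first by rewrite mulr_ge0 ?invr_ge0 ?ltW.
  (* The quadratic term pays for normalizing: y / 4 is at most 1 / 4 + y ^ 2 / 8, here with y =
     [c * s]. *)
  have : Z / t * (c * s / 4) <= c * mxdot G (D0 (f, g)).
    apply: le_trans H; rewrite (ler_wpM2l (ltW (divr_gt0 Z0 t0)))//.
    by have := sqr_ge0 (c * s - 1); rewrite !expr2; lra.
  rewrite (_ : _ * (c * s / 4) = c * (Z * s / (4 * t))); last by field; rewrite gt_eqF.
  rewrite ler_pM2l// ler_pdivrMr ?mulr_gt0// => {}H.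
  by rewrite [s^-1 * _]mulrC mulrA ler_pdivlMr// mulrC [leRHS]mulrC mulrC.
exists {x | x \in finset.setX U_ W_}, (D \o val); split => [|i|G B rB].
- have E a : 2 ^+ (4 * a) * 4 ^+ a = 64 ^+ a :> R.
    by rewrite exprM -exprMn; congr (_ ^+ _); ring.
  rewrite card_sig (_ : #|_| = #|finset.setX U_ W_|); last exact: eq_card.
  rewrite cardsX natrM (le_trans (ler_pM _ _ (card_lattice_ball R _ _ _)
    (card_lattice_ball R _ _ _)))//.
  by rewrite !card_prod !card_ord !E -exprD -mulnDl mulnC.
- exact: D1.
- by have [fg fgUW H] := Dnet G B rB; exists (Sub fg fgUW).
Qed.

(** * The deterministic oracle inequality *)

Lemma norm2_rowE (R : realType) n m (C : 'M[R]_(n, m)) i :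
  norm2_row C i = frob (row i C).
Proof.
rewrite /norm2_row /frob big_ord1; congr Num.sqrt.
by apply: eq_bigr => j _; rewrite mxE.
Qed.

Lemma mxdot_rows (R : comNzRingType) n m (A B : 'M[R]_(n, m)) :
  mxdot A B = \sum_i mxdot (row i A) (row i B).
Proof.
rewrite mxdotE; apply: eq_bigr => i _; rewrite mxdotE big_ord1.
by apply: eq_bigr => j _; rewrite !mxE.
Qed.

Lemma ler_frobD (R : realType) n m (A B : 'M[R]_(n, m)) :
  frob (A + B) <= frob A + frob B.
Proof.
rewrite -(ler_pXn2r (n := 2))// ?nnegrE ?addr_ge0 ?frob_ge0//.
rewrite frob_sqr sqrrD !frob_sqr mxdotDl !mxdotDr (mxdotC B A).
by have := mxdot_CS A B; lra.
Qed.

Lemma frobN (R : realType) n m (A : 'M[R]_(n, m)) : frob (- A) = frob A.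
Proof.
by rewrite /frob; congr Num.sqrt; do 2 apply: eq_bigr => ? _; rewrite mxE sqrrN.
Qed.

(** With [s] the norm of [8 *: e - v] and [t] that of [c], adding [c] gains at most s t / 8 - t ^ 2
    / 16 - l t. This is nonpositive if s <= 8 l; otherwise its maximum over t is (s - 8 l) ^ 2 / 16,
    and the part without [c] equals 4 |e| ^ 2 - s ^ 2 / 16. *)
Lemma penalized_row_bound (R : realType) n m (e v c : 'M[R]_(n, m)) (l : R) :
    0 <= l ->
  let f := mxdot e (v + c) - mxdot (v + c) (v + c) / 16 - l * frob c in
  f <= mxdot e v - mxdot v v / 16 \/ f <= 4 * (mxdot e e - l ^+ 2).
Proof.
move=> l0 f.
have := mxdot_CS (8 *: e - v) c; have := frob_sqr (8 *: e - v).
have := frob_sqr c; have := frob_ge0 c; have := frob_ge0 (8 *: e - v).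
rewrite {}/f; set s := frob (_ - _); set t := frob c.
rewrite !(mxdotDl, mxdotDr, mxdotNl, mxdotNr, mxdotZl, mxdotZr) (mxdotC v e) (mxdotC c v).
set ee := mxdot e e; set ev := mxdot e v; set ec := mxdot e c.
set vv := mxdot v v; set vc := mxdot v c; set cc := mxdot c c.
move=> s0 t0 tE sE st; have [sl|sl] := leP s (8 * l); [left|right].
  have : s * t <= 8 * l * t by rewrite ler_wpM2r.
  by have := sqr_ge0 t; lra.
have : l * (8 * l) <= l * s by rewrite ler_wpM2l// ltW.
have := sqr_ge0 ((s - t) / 4 - 2 * l).
by lra.
Qed.

(** Erasing rows by a matrix product turns [X] into another design matrix of no larger rank, to
    which [rank_ball_net] applies. *)
Definition row_mask (R : pzRingType) n (J : {set 'I_n}) : 'M[R]_n :=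
  diag_mx (\row_i (i \notin J)%:R).

Lemma row_row_mask (R : pzRingType) n m (J : {set 'I_n}) (V : 'M[R]_(n, m)) i :
  row i (row_mask R J *m V) = (i \notin J)%:R *: row i V.
Proof. by rewrite row_mul row_diag_mx mxE -scalemxAl -rowE. Qed.

Lemma penalized_noise_split (R : realType) n m (E V C : 'M[R]_(n, m)) (l : R) :
    0 <= l ->
  exists J : {set 'I_n},
    mxdot E (V + C) - mxdot (V + C) (V + C) / 16 - l * norm21 C <=
    \sum_(i in J) 4 * (mxdot (row i E) (row i E) - l ^+ 2) +
    (mxdot E (row_mask R J *m V) -
     mxdot (row_mask R J *m V) (row_mask R J *m V) / 16).
Proof.
move=> l0.
pose f i := mxdot (row i E) (row i V + row i C)
  - mxdot (row i V + row i C) (row i V + row i C) / 16 - l * frob (row i C).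
pose g i := mxdot (row i E) (row i V) - mxdot (row i V) (row i V) / 16.
(* The rows where the first alternative of [penalized_row_bound] fails. *)
exists [set i | ~~ (f i <= g i)]%SET; set J := finset _.
have -> : mxdot E (V + C) - mxdot (V + C) (V + C) / 16 - l * norm21 C
    = \sum_i f i.
  rewrite !sumrB /norm21 !mxdot_rows mulr_suml mulr_sumr.
  by congr (_ - _ - _); apply: eq_bigr => i _; rewrite ?linearD ?norm2_rowE.
have -> : mxdot E (row_mask R J *m V) -
     mxdot (row_mask R J *m V) (row_mask R J *m V) / 16
    = \sum_(i | i \notin J) g i.
  rewrite big_mkcond !mxdot_rows mulr_suml -sumrB; apply: eq_bigr => i _.
  rewrite row_row_mask mxdotZr mxdotZl mxdotZr; case: ifP => _.
    by rewrite !mul1r.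
  by rewrite !mul0r subr0.
rewrite (bigID (mem J)) /= lerD// ler_sum// => i.
  rewrite finset.inE => fg.
  by case: (penalized_row_bound (row i E) (row i V) (row i C) l0) => // {}fg'; rewrite fg' in fg.
by rewrite finset.inE negbK.
Qed.

Lemma norm21_split (R : realType) n m (J : {set 'I_n}) (C : 'M[R]_(n, m)) :
  norm21 C = norm21_on J C + norm21_on (~: J)%SET C.
Proof.
rewrite /norm21 (bigID (mem J)) /=; congr (_ + _).
by apply: eq_bigl => i; rewrite finset.inE.
Qed.

(** Off its support [C] vanishes, so [C' - C] is [C'] there; on the support the triangle inequality
    applies row by row. *)
Lemma norm21_supp_cone (R : realType) n m (C C' : 'M[R]_(n, m)) :
  norm21 C - norm21 C' <=
  norm21_on (row_supp C) (C' - C) - norm21_on (~: row_supp C)%SET (C' - C).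
Proof.
rewrite (norm21_split (row_supp C) C) (norm21_split (row_supp C) C').
have -> : norm21_on (~: row_supp C)%SET C = 0.
  apply: big1 => i; rewrite !finset.inE negbK => /eqP Ci.
  by rewrite norm2_rowE Ci /frob big_ord1 big1 ?sqrtr0// => j _; rewrite mxE expr0n.
have -> : norm21_on (~: row_supp C)%SET (C' - C) = norm21_on (~: row_supp C)%SET C'.
  apply: eq_bigr => i; rewrite !finset.inE negbK => /eqP Ci.
  by rewrite !norm2_rowE linearB /= Ci subr0.
have : norm21_on (row_supp C) C <=
    norm21_on (row_supp C) C' + norm21_on (row_supp C) (C' - C).
  rewrite -big_split /=; apply: ler_sum => i _; rewrite !norm2_rowE.
  rewrite -[frob (row i (C' - C))]frobN -linearN /= opprB.
  by rewrite {1}(_ : C = C' + (C - C')) ?linearD /= ?ler_frobD// addrC subrK.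
by lra.
Qed.

(* The noise enters only through [S], which bounds the penalized noise process
   over all pairs of a matrix of rank at most [2 * r] and an arbitrary one. *)
Lemma oracle_inequality (R : realType) n p m r (theta K lam S : R)
    (X : 'M[R]_(n, p)) (Bs B Bh : 'M[R]_(p, m)) (Cs C Ch E : 'M[R]_(n, m)) :
    0 < theta -> 0 <= K -> 0 <= lam -> (\rank B <= r)%N ->
    is_argmin lam r (X *m Bs + Cs + E) X Bh Ch ->
    design_condition m r theta K X (row_supp C) ->
    (forall (V : 'M[R]_(p, m)) (W : 'M[R]_(n, m)), (\rank V <= 2 * r)%N ->
      mxdot E (X *m V + W) - mxdot (X *m V + W) (X *m V + W) / 16
      - theta / (2 + theta) * lam * norm21 W <= S) ->
  Mloss X (Bh - Bs) (Ch - Cs) <=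
    3 * Mloss X (B - Bs) (C - Cs) + 16 * lam ^+ 2 * K ^+ 2 * #|row_supp C|%:R
    + 4 * S.
Proof.
move=> theta0 K0 lam0 rB [rBh Bh_min] design noise.
have {Bh_min}opt := Bh_min B C rB; rewrite /objective in opt.
rewrite /Mloss; set a := X *m (Bh - Bs) + _; set b := X *m (B - Bs) + _.
have aE : X *m Bs + Cs + E - X *m Bh - Ch = E - a.
  by rewrite /a mulmxBr; apply/matrixP => i j; rewrite !mxE; ring.
have bE : X *m Bs + Cs + E - X *m B - C = E - b.
  by rewrite /b mulmxBr; apply/matrixP => i j; rewrite !mxE; ring.
rewrite {}aE {}bE in opt.
pose V := Bh - B; pose W := Ch - C.
have rV : (\rank V <= 2 * r)%N.
  by rewrite (leq_trans (mxrank_add _ _))// mxrank_opp mul2n -addnn leq_add.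
have DE : X *m V + W = a - b.
  by rewrite /a /b /V /W !mulmxBr; apply/matrixP => i j; rewrite !mxE; ring.
have rXV : (\rank (X *m V) <= 2 * r)%N by rewrite (leq_trans (mxrankM_maxr _ _)).
(* The complementary projection kills [X *m V], so applied to [W] it gives the same as applied to
   [a - b], whose norm is under control. *)
have [Q [QXV QQ Qsub]] := partial_isometry_col_basis rXV.
have QP := partial_isometry_projection QQ.
have pen : (1 + theta) * norm21_on (row_supp C) W <=
    norm21_on (~: row_supp C)%SET W
    + K * Num.sqrt #|row_supp C|%:R * frob (a - b).
  apply: le_trans (design W (Q *m Q^T) QP _ _) _.
  - rewrite /colspace_sub trmx_mul trmxK (submx_trans (submxMl _ _))//.
    by rewrite (submx_trans Qsub)// trmx_mul submxMl.
  - by rewrite (leq_trans (mxrankM_maxl _ _))// rank_leq_col.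
  - rewrite lerD2l ler_wpM2l ?mulr_ge0 ?sqrtr_ge0//.
    have -> : (1%:M - Q *m Q^T) *m W = (1%:M - Q *m Q^T) *m (a - b).
      by rewrite -DE [RHS]mulmxDr [X in _ = X + _]mulmxBl mul1mx QXV subrr add0r.
    rewrite -(ler_pXn2r (n := 2))// ?nnegrE ?frob_ge0// !frob_sqr.
    exact: orthogonal_projection_contract (orthogonal_projectionC QP).
have := noise V W rV; rewrite DE (norm21_split (row_supp C) W).
have := norm21_supp_cone C Ch; rewrite -/W.
move: opt pen; rewrite !frob_sqr.
set ch := norm21 Ch; set c0 := norm21 C.
set nJ := norm21_on (row_supp C) W; set nJc := norm21_on (~: row_supp C)%SET W.
set J := #|row_supp C|%:R; set f := frob (a - b) => opt pen cone {}noise.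
have fE : f ^+ 2 = mxdot (a - b) (a - b) by exact: frob_sqr.
clearbody a b.
have JJ : Num.sqrt J ^+ 2 = J by rewrite sqr_sqrtr// ler0n.
(* This bounds the squared norm of [a - b] by twice the sum of those of [a] and [b], so that an
   eighth of it can be absorbed on the left. *)
have par := mxdot_ge0 (a + b).
move: opt noise fE par; rewrite !(mxdotDl, mxdotDr, mxdotNl, mxdotNr).
rewrite (mxdotC a E) (mxdotC b E) (mxdotC b a) => opt noise fE par.
have th : 0 < 2 + theta by lra.
have f16 : lam * K * Num.sqrt J * f <= f ^+ 2 / 16 + 4 * lam ^+ 2 * K ^+ 2 * J.
  have := sqr_ge0 (f / 4 - 2 * (lam * K * Num.sqrt J)).
  rewrite (_ : 4 * _ * _ * J = 4 * lam ^+ 2 * K ^+ 2 * Num.sqrt J ^+ 2).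
    by lra.
  by rewrite JJ.
(* The share [theta / (2 + theta)] of the penalty given to the noise is the one that turns the
   remainder into a multiple of the quantity in the design condition. *)
have eps : theta / (2 + theta) * lam * (nJ + nJc) + lam * (nJ - nJc) =
    2 / (2 + theta) * lam * ((1 + theta) * nJ - nJc).
  by field; rewrite gt_eqF.
have pen' : 2 / (2 + theta) * lam * ((1 + theta) * nJ - nJc) <=
    lam * K * Num.sqrt J * f.
  have c1 : 2 / (2 + theta) * lam <= lam.
    by rewrite -[leRHS]mul1r ler_wpM2r// ler_pdivrMr// mul1r; lra.
  have c0' : 0 <= 2 / (2 + theta) * lam by rewrite mulr_ge0// divr_ge0// ltW.
  have K0' : 0 <= K * Num.sqrt J * f by rewrite !mulr_ge0 ?sqrtr_ge0 ?frob_ge0.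
  apply: (@le_trans _ _ (2 / (2 + theta) * lam * (K * Num.sqrt J * f))).
    by rewrite ler_wpM2l//; lra.
  by apply: le_trans (ler_wpM2r K0' c1) _; rewrite !mulrA.
have := ler_wpM2l lam0 cone.
by lra.
Qed.

(** * Expectation of the noise *)

(** Measurability and nonnegativity travel with the bound, so that bounds can be added and scaled
    without integrability hypotheses. *)
Definition mean_le d (T : measurableType d) (R : realType)
    (P : probability T R) (f : T -> R) (b : R) : Prop :=
  [/\ measurable_fun [set: T] f, forall w, 0 <= f w &
      (\int[P]_w (f w)%:E <= b%:E)%E].

Lemma mean_le_cst d (T : measurableType d) (R : realType)
    (P : probability T R) (c : R) : 0 <= c -> mean_le P (fun=> c) c.
Proof.
by move=> c0; split => //; rewrite integral_cst//= probability_setT mule1.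
Qed.

Lemma mean_leD d (T : measurableType d) (R : realType) (P : probability T R)
    (f g : T -> R) (a b : R) : mean_le P f a -> mean_le P g b ->
  mean_le P (fun w => f w + g w) (a + b).
Proof.
move=> [mf f0 fa] [mg g0 gb]; split => [|w|].
- exact: measurable_funD.
- by rewrite addr_ge0.
under eq_integral do rewrite EFinD.
rewrite ge0_integralD ?EFinD ?leeD//; try exact/measurable_EFinP.
- by move=> w _; rewrite lee_fin.
- by move=> w _; rewrite lee_fin.
Qed.

Lemma mean_leZ d (T : measurableType d) (R : realType) (P : probability T R)
    (f : T -> R) (c a : R) : 0 <= c -> mean_le P f a ->
  mean_le P (fun w => c * f w) (c * a).
Proof.
move=> c0 [mf f0 fa]; split => [|w|].
- exact: measurable_funM.
- by rewrite mulr_ge0.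
under eq_integral do rewrite EFinM.
rewrite ge0_integralZl ?EFinM//.
- by rewrite lee_wpmul2l ?lee_fin.
- exact/measurable_EFinP.
- by move=> w _; rewrite lee_fin.
Qed.

Lemma mean_le_sum d (T : measurableType d) (R : realType) (P : probability T R)
    (I : finType) (f : I -> T -> R) (a : I -> R) :
  (forall i, mean_le P (f i) (a i)) ->
  mean_le P (fun w => \sum_i f i w) (\sum_i a i).
Proof.
move=> fa; elim: (index_enum I) => [|i s IH].
  rewrite big_nil; under eq_fun do rewrite big_nil.
  exact: mean_le_cst.
rewrite big_cons; under eq_fun do rewrite big_cons.
exact: mean_leD.
Qed.

Lemma mean_leW d (T : measurableType d) (R : realType) (P : probability T R)
    (f : T -> R) (a b : R) : mean_le P f a -> a <= b -> mean_le P f b.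
Proof.
by move=> [mf f0 fa] ab; split => //; apply: le_trans fa _; rewrite lee_fin.
Qed.

Lemma iid_normal_mean_le_exp_linear d (T : measurableType d) (R : realType)
    (P : probability T R) (I : finType) (s : R) (Z : I -> {RV P >-> R})
    (a : I -> R) : 0 < s -> iid_centered_normal s Z ->
  mean_le P (fun w => expR (\sum_k a k * Z k w))
    (expR (s ^+ 2 / 2 * \sum_k a k ^+ 2)).
Proof.
move=> s0 iidZ; split; last by rewrite (iid_normal_exp_linear _ s0).
  apply: measurableT_comp => //; apply: measurable_sum => k.
  exact: measurable_funM.
by move=> w; exact: expR_ge0.
Qed.

Lemma iid_normal_mean_le_exp_square d (T : measurableType d) (R : realType)
    (P : probability T R) (I : finType) (s : R) (Z : I -> {RV P >-> R})
    (A : {set I}) : 0 < s -> iid_centered_normal s Z ->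
  mean_le P (fun w => expR ((\sum_(k in A) Z k w ^+ 2) / (4 * s ^+ 2)))
    (expR 1 ^+ #|A|).
Proof.
move=> s0 iidZ; split.
- apply: measurableT_comp => //; apply: measurable_funM => //.
  rewrite (_ : (fun w => _) =
      (fun w => \sum_k if k \in A then Z k w ^+ 2 else 0)); last first.
    by apply/funext => w; exact: big_mkcond.
  apply: measurable_sum => k; case: (k \in A) => //.
  exact: measurable_funX.
- by move=> w; exact: expR_ge0.
- rewrite (iid_normal_exp_square _ s0)// lee_fin lerXn2r ?nnegrE ?sqrtr_ge0//
    ?expR_ge0//.
  have e2 : 2 <= expR 1 :> R by have := expR_ge1Dx (1 : R); lra.
  have : Num.sqrt 2 ^+ 2 <= 2 ^+ 2 :> R by rewrite sqr_sqrtr//; lra.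
  by rewrite ler_pXn2r ?nnegrE ?sqrtr_ge0// => /le_trans; apply.
Qed.

(** For x > t, put u = t (x - t) / s ^ 2. As s <= t, the excess of x ^ 2 over t ^ 2 is at most s ^ 2
    (2 u + u ^ 2), and (1 + u / 2) ^ 2 <= exp u. A squared maximum can thus be bounded by a sum of
    Gaussian exponential moments. *)
Lemma sqr_le_expR (R : realType) (x t s : R) : 0 < s -> s <= t -> 0 <= x ->
  x ^+ 2 <= t ^+ 2 + 4 * s ^+ 2 * expR (t * (x - t) / s ^+ 2).
Proof.
move=> s0 st x0; have s20 : 0 < s ^+ 2 by exact: exprn_gt0.
have [xt|tx] := leP x t.
  rewrite -[leLHS]addr0 lerD//; last by rewrite mulr_ge0 ?expR_ge0// mulr_ge0// ltW.
  by rewrite lerXn2r ?nnegrE// (le_trans x0).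
set u := _ / _.
have uE : s ^+ 2 * u = t * (x - t) by rewrite /u mulrC divfK// gt_eqF.
have u0 : 0 <= u by rewrite divr_ge0// ?mulr_ge0 ?subr_ge0// ltW// (lt_le_trans s0).
have eu : (1 + u / 2) ^+ 2 <= expR u.
  rewrite {2}(splitr u) expRD -expr2 lerXn2r ?nnegrE ?expR_ge0//.
    by rewrite addr_ge0// divr_ge0.
  exact: expR_ge1Dx.
have xt2 : (x - t) ^+ 2 <= s ^+ 2 * u ^+ 2.
  rewrite -(ler_pM2l s20).
  rewrite (_ : s ^+ 2 * (s ^+ 2 * u ^+ 2) = (s ^+ 2 * u) ^+ 2); last by ring.
  rewrite uE exprMn ler_wpM2r ?sqr_ge0//.
  by rewrite lerXn2r ?nnegrE// ltW// (lt_le_trans s0).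
have := ler_wpM2l (ltW s20) eu; have := mulr_ge0 (ltW s20) u0.
by rewrite !expr2 in uE xt2 *; lra.
Qed.

Lemma sum_expr_card (R : comNzRingType) n (x : R) :
  \sum_(J : {set 'I_n}) x ^+ #|J| = (1 + x) ^+ n.
Proof.
transitivity (\prod_(i < n) (x + 1)); last first.
  by rewrite prodr_const card_ord addrC.
rewrite bigA_distr; apply: eq_bigr => J _.
by rewrite -big_mkcond /= prodr_const.
Qed.

(** The set [J] and the net point depend on the noise. Summing nonnegative exponentials over all
    choices gives a bound free of [V] and [W]. *)
Lemma noise_bound (R : realType) n p m k (sigma l g N : R) (X : 'M[R]_(n, p))
    (I : {set 'I_n} -> finType) (D : forall J, I J -> 'M[R]_(n, m))
    (T : {set 'I_n} -> R) (E W : 'M[R]_(n, m)) (V : 'M[R]_(p, m)) :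
    0 < sigma -> 0 <= g -> 0 <= N -> 0 <= l ->
    32 * 12 * sigma ^+ 2 * g <= l ^+ 2 -> (\rank V <= k)%N ->
    (forall J (G : 'M[R]_(n, m)) (B : 'M[R]_(p, m)), (\rank B <= k)%N ->
      exists i, 0 <= mxdot G (D J i) /\
        mxdot G (row_mask R J *m X *m B) <=
        4 * frob (row_mask R J *m X *m B) * mxdot G (D J i)) ->
    (forall J, 0 <= T J /\ T J ^+ 2 = 12 * sigma ^+ 2 * (1 + N + #|J|%:R * g)) ->
  mxdot E (X *m V + W) - mxdot (X *m V + W) (X *m V + W) / 16 - l * norm21 W <=
  64 * 12 * sigma ^+ 2 * (1 + N)
  + \sum_i 16 * sigma ^+ 2 *
      expR ((mxdot (row i E) (row i E) - l ^+ 2 / 2) / (4 * sigma ^+ 2))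
  + \sum_J \sum_(i : I J) 64 * 4 * sigma ^+ 2 *
      expR (T J * (mxdot E (D J i) - T J) / sigma ^+ 2).
Proof.
move=> s0 g0 N0 l0 lg rV net TE.
have s20 : 0 < sigma ^+ 2 by exact: exprn_gt0.
have [J HJ] := penalized_noise_split E (X *m V) W l0.
apply: le_trans HJ _; rewrite mulmxA.
have [i [x0 Hx]] := net J E V rV; set x := mxdot E (D J i) in x0 Hx.
set f := frob _ in Hx; rewrite -frob_sqr -/f.
have [T0 T2] := TE J.
have sT : sigma <= T J.
  rewrite -(ler_pXn2r (n := 2)) ?nnegrE ?(ltW s0)// T2.
  have : 0 <= sigma ^+ 2 * (N + #|J|%:R * g).
    by apply: mulr_ge0; [exact: ltW|rewrite addr_ge0// mulr_ge0].
  by lra.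
have xT := sqr_le_expR s0 sT x0.
(* From 4 f x <= f ^ 2 / 16 + 64 x ^ 2, the norm [f] is absorbed by the quadratic term. *)
have fx : mxdot E (row_mask R J *m X *m V) - f ^+ 2 / 16 <= 64 * x ^+ 2.
  by have := sqr_ge0 (f / 4 - 8 * x); rewrite !expr2; lra.
have net_le : 64 * 4 * sigma ^+ 2 * expR (T J * (x - T J) / sigma ^+ 2) <=
    \sum_J \sum_(i : I J) 64 * 4 * sigma ^+ 2 *
      expR (T J * (mxdot E (D J i) - T J) / sigma ^+ 2).
  have e0 J' (j : I J') : 0 <= 64 * 4 * sigma ^+ 2 *
      expR (T J' * (mxdot E (D J' j) - T J') / sigma ^+ 2).
    by rewrite mulr_ge0 ?expR_ge0// !mulr_ge0 ?(ltW s0).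
  rewrite (bigD1 J)//= (bigD1 i)//= -/x -addrA lerDl.
  by rewrite addr_ge0 ?sumr_ge0// => J' _; rewrite sumr_ge0.
(* Half of each [4 * l ^+ 2] stays outside as a negative term; the rest is bounded through 1 + u <=
   exp u. *)
have row_le : \sum_(i in J) 4 * (mxdot (row i E) (row i E) - l ^+ 2) <=
    \sum_i 16 * sigma ^+ 2 *
      expR ((mxdot (row i E) (row i E) - l ^+ 2 / 2) / (4 * sigma ^+ 2))
    - 2 * l ^+ 2 * #|J|%:R.
  rewrite lerBrDr mulr_natr -sumr_const -big_split /= [leRHS](bigID (mem J)) /=.
  rewrite -[leLHS]addr0 lerD//; last first.
    by apply: sumr_ge0 => j _; rewrite mulr_ge0 ?expR_ge0// mulr_ge0// ltW.
  apply: ler_sum => j _; set y := mxdot _ _.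
  have := expR_ge1Dx ((y - l ^+ 2 / 2) / (4 * sigma ^+ 2)); set e := expR _ => He.
  have : 16 * sigma ^+ 2 * ((y - l ^+ 2 / 2) / (4 * sigma ^+ 2)) <= 16 * sigma ^+ 2 * e.
    by apply: ler_wpM2l; [rewrite mulr_ge0// ltW|lra].
  have -> : 16 * sigma ^+ 2 * ((y - l ^+ 2 / 2) / (4 * sigma ^+ 2)) =
      4 * (y - l ^+ 2 / 2) by field; rewrite gt_eqF.
  by lra.
(* The negative term [2 * l ^+ 2 * #|J|%:R] covers the part of [64 * T J ^+ 2] that grows with
   [J]. *)
have := ler_wpM2r (ler0n R #|J|) lg.
by move: xT; rewrite T2; lra.
Qed.

(** The logarithm in the rate pays for a sum over [n] rows. It is an inequality since the left side
    is 0 for [n = 0]. *)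
Lemma natr_expRN_ln_le1 (R : realType) n : n%:R * expR (- ln n%:R) <= 1 :> R.
Proof.
case: n => [|n]; first by rewrite mul0r.
by rewrite expRN lnK ?posrE ?ltr0n// divff// pnatr_eq0.
Qed.

(** Chernoff exponent: the Gaussian moment gives back at most half of [t ^+ 2 / sigma ^+ 2]. *)
Lemma noise_linear_mean_le d (T : measurableType d) (R : realType)
    (P : probability T R) n m (sigma t : R) (E : 'I_n * 'I_m -> {RV P >-> R})
    (D : 'M[R]_(n, m)) :
    0 < sigma -> iid_centered_normal sigma E -> mxdot D D <= 1 ->
  mean_le P (fun w => expR (t * (mxdot (\matrix_(i, j) E (i, j) w) D - t)
                            / sigma ^+ 2))
    (expR (- (t ^+ 2 / (2 * sigma ^+ 2)))).
Proof.
move=> s0 iidE D1.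
pose a (x : 'I_n * 'I_m) := t / sigma ^+ 2 * D x.1 x.2.
have aE : \sum_x a x ^+ 2 = (t / sigma ^+ 2) ^+ 2 * mxdot D D.
  rewrite mxdotE pair_bigA mulr_sumr; apply: eq_bigr => x _.
  by rewrite exprMn expr2.
have := mean_leZ (expR_ge0 (- (t ^+ 2 / sigma ^+ 2)))
  (iid_normal_mean_le_exp_linear a s0 iidE).
set f := (X in mean_le _ X _); set g := (X in _ -> mean_le _ X _).
have -> : f = g.
  apply/funext => w; rewrite /f /g -expRD mxdotE pair_bigA; congr expR.
  rewrite mulrBr mulrBl addrC -expr2; congr (_ - _).
  rewrite mulr_sumr mulr_suml; apply: eq_bigr => -[i j] _ /=.
  by rewrite mxE /a; ring.
move=> /mean_leW; apply; rewrite -expRD ler_expR aE.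
have : (t / sigma ^+ 2) ^+ 2 * mxdot D D <= (t / sigma ^+ 2) ^+ 2.
  by rewrite -[leRHS]mulr1 ler_wpM2l ?sqr_ge0.
move=> /(ler_wpM2l (divr_ge0 (ltW (exprn_gt0 2 s0)) (ler0n R 2))).
set u := (X in X <= _ -> _).
rewrite (_ : sigma ^+ 2 / 2 * (t / sigma ^+ 2) ^+ 2 = t ^+ 2 / (2 * sigma ^+ 2)).
  rewrite (_ : t ^+ 2 / sigma ^+ 2 = 2 * (t ^+ 2 / (2 * sigma ^+ 2))).
    by set v := t ^+ 2 / _ => uv; rewrite -/u; lra.
  by field; rewrite gt_eqF.
by field; rewrite gt_eqF.
Qed.

Lemma noise_row_mean_le d (T : measurableType d) (R : realType)
    (P : probability T R) n m (sigma b : R) (E : 'I_n * 'I_m -> {RV P >-> R})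
    (i : 'I_n) : 0 < sigma -> iid_centered_normal sigma E ->
  let Ew w : 'M[R]_(n, m) := \matrix_(i, j) E (i, j) w in
  mean_le P (fun w => expR ((mxdot (row i (Ew w)) (row i (Ew w)) - b)
                            / (4 * sigma ^+ 2)))
    (expR (m%:R - b / (4 * sigma ^+ 2))).
Proof.
move=> s0 iidE Ew; pose S := [set x : 'I_n * 'I_m | x.1 == i]%SET.
have cS : #|S| = m.
  rewrite (_ : S = finset.setX [set i]%SET [set: 'I_m]%SET).
    by rewrite cardsX cards1 cardsT card_ord mul1n.
  by apply/setP => x; rewrite !finset.inE andbT.
have := mean_leZ (expR_ge0 (- (b / (4 * sigma ^+ 2))))
  (iid_normal_mean_le_exp_square S s0 iidE).
set f := (X in mean_le _ X _); set g := (X in _ -> mean_le _ X _).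
have -> : f = g.
  apply/funext => w; rewrite /f /g -expRD; congr expR.
  rewrite mulrBl addrC; congr (_ / _ - _).
  rewrite mxdotE big_ord1.
  rewrite (eq_big (fun x => (x.1 == i) && predT x.2)
    (fun x => E (x.1, x.2) w ^+ 2)); last 2 first.
  - by move=> x; rewrite finset.inE andbT.
  - by case.
  rewrite -(pair_big (fun a => a == i) predT (fun a j => E (a, j) w ^+ 2)) /= big_pred1_eq.
  by apply: eq_bigr => j _; rewrite !mxE expr2.
by rewrite cS -[expR 1 ^+ m]expRM_natl mulr1 -expRD addrC.
Qed.

Lemma noise_mean_le d (T : measurableType d) (R : realType)
    (P : probability T R) n m K (sigma l : R) (E : 'I_n * 'I_m -> {RV P >-> R})
    (I : {set 'I_n} -> finType) (D : forall J, I J -> 'M[R]_(n, m))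
    (t : {set 'I_n} -> R) :
    0 < sigma -> iid_centered_normal sigma E ->
    let g := m%:R + ln n%:R in 0 <= ln (n%:R : R) ->
    32 * 12 * sigma ^+ 2 * g <= l ^+ 2 ->
    (forall J, #|I J|%:R <= 64 ^+ K :> R) ->
    (forall J i, mxdot (D J i) (D J i) <= 1) ->
    (forall J, t J ^+ 2 = 12 * sigma ^+ 2 * (1 + K%:R + #|J|%:R * g)) ->
  let Ew w : 'M[R]_(n, m) := \matrix_(i, j) E (i, j) w in
  mean_le P (fun w => 64 * 12 * sigma ^+ 2 * (1 + K%:R)
  + \sum_i 16 * sigma ^+ 2 *
      expR ((mxdot (row i (Ew w)) (row i (Ew w)) - l ^+ 2 / 2) / (4 * sigma ^+ 2))
  + \sum_J \sum_(i : I J) 64 * 4 * sigma ^+ 2 *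
      expR (t J * (mxdot (Ew w) (D J i) - t J) / sigma ^+ 2))
  (64 * 12 * sigma ^+ 2 * (1 + K%:R) + 16 * sigma ^+ 2 + 64 * 4 * sigma ^+ 2 * expR 1).
Proof.
move=> s0 iidE g ln0 lg cI D1 tE Ew.
have s20 : 0 < sigma ^+ 2 by exact: exprn_gt0.
have c0 (c : R) : 0 <= c -> 0 <= c * sigma ^+ 2.
  by move=> ?; rewrite mulr_ge0// ltW.
have g0 : 0 <= g by rewrite addr_ge0.
apply: mean_leD; first apply: mean_leD.
- by apply: mean_le_cst; apply: mulr_ge0; [exact: c0|exact: addr_ge0].
- apply: (@mean_leW _ _ _ _ _ (\sum_(i < n) 16 * sigma ^+ 2 *
      expR (m%:R - l ^+ 2 / 2 / (4 * sigma ^+ 2)))).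
    apply: mean_le_sum => i; apply: mean_leZ; first exact: c0.
    exact: noise_row_mean_le.
  rewrite sumr_const card_ord -[leLHS]mulr_natl mulrCA -[leRHS]mulr1.
  rewrite (ler_wpM2l (c0 _ _))//.
  apply: le_trans (natr_expRN_ln_le1 R n); rewrite ler_wpM2l// ler_expR.
  (* Since 48 g >= g = m + ln n, the exponent of each row is at most [- ln n%:R]. *)
  have : 48 * g <= l ^+ 2 / 2 / (4 * sigma ^+ 2).
    by rewrite ler_pdivlMr ?mulr_gt0//; lra.
  by move: g0; rewrite /g; lra.
- apply: (@mean_leW _ _ _ _ _ (\sum_J \sum_(i : I J) 64 * 4 * sigma ^+ 2 *
      expR (- (t J ^+ 2 / (2 * sigma ^+ 2))))).
    apply: mean_le_sum => J; apply: mean_le_sum => i.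
    apply: mean_leZ; first exact: c0.
    exact: noise_linear_mean_le.
  have e2 : 2 <= expR 1 :> R by have := expR_ge1Dx (1 : R); lra.
  have e64 : 64 ^+ K <= expR (6 * K%:R) :> R.
    rewrite mulrC expRM_natl lerXn2r ?nnegrE ?expR_ge0//.
    rewrite -[6]mulr1 expRM_natl (_ : 64 = 2 ^+ 6); last by ring.
    by rewrite lerXn2r ?nnegrE ?expR_ge0.
  (* The factor 12 in [t J ^+ 2] gives the exponent -6 (1 + K + |J| g): its part 6 K cancels the net
     size, as 64 <= exp 6, and a price exp (- g) for each row of [J] is kept. *)
  apply: (@le_trans _ _ (\sum_(J : {set 'I_n}) 64 * 4 * sigma ^+ 2 * expR (- g) ^+ #|J|)).
    apply: ler_sum => J _; rewrite sumr_const -[leLHS]mulr_natl mulrCA.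
    rewrite (ler_wpM2l (c0 _ _))//.
    apply: le_trans (ler_wpM2r (expR_ge0 _) (le_trans (cI J) e64)) _.
    rewrite -expRM_natl -expRD ler_expR tE.
    rewrite (_ : 12 * _ * _ / _ = 6 * (1 + K%:R + #|J|%:R * g)).
      have : 0 <= #|J|%:R * g by rewrite mulr_ge0.
      by lra.
    by field; rewrite gt_eqF.
  rewrite -mulr_sumr (ler_wpM2l (c0 _ _))// sum_expr_card.
  (* (1 + exp (- g)) ^ n <= exp (n exp (- g)) <= exp 1, as g >= ln n. *)
  apply: (@le_trans _ _ (expR (expR (- g)) ^+ n)).
    by rewrite lerXn2r ?nnegrE ?expR_ge0 ?expR_ge1Dx// addr_ge0 ?expR_ge0.
  rewrite -expRM_natl ler_expR; apply: le_trans (natr_expRN_ln_le1 R n).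
  by rewrite ler_wpM2l// ler_expR /g opprD gerDr oppr_le0.
Qed.

(** * Collecting the constants and the risk bound *)

Lemma risk_constants_le (R : realFieldType) (a e M s u v : R) :
    0 <= a -> 0 <= e -> 0 <= M -> 0 <= s -> 0 <= u -> 0 <= v ->
  3 * M + 16 * a * (s * v) +
  4 * (64 * 12 * s * (1 + 2 * u) + 16 * s + 64 * 4 * s * e) <=
  (16 * a + 100 ^+ 2 + 32 ^+ 2 * e) * (M + s + s * u + s * v).
Proof.
move=> a0 e0 M0 s0 u0 v0.
have su0 := mulr_ge0 s0 u0; have sv0 := mulr_ge0 s0 v0.
have := mulr_ge0 a0 M0; have := mulr_ge0 a0 s0; have := mulr_ge0 a0 su0.
have := mulr_ge0 e0 M0; have := mulr_ge0 e0 su0; have := mulr_ge0 e0 sv0.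
by lra.
Qed.

Theorem theorem6 (R : realType) (theta : R) (htheta : 0 < theta) :
  exists A0 : R, 0 < A0 /\ forall A : R, A0 <= A ->
  exists c : R, 0 < c /\
  forall (n m p r : nat) (sigma K : R) (hsigma : 0 < sigma) (hK : 0 <= K)
    (X : 'M[R]_(n, p)) (Bs : 'M[R]_(p, m)) (Cs : 'M[R]_(n, m))
    (d : measure_display) (T : measurableType d) (P : probability T R)
    (E : 'I_n * 'I_m -> {RV P >-> R})
    (Bh : T -> 'M[R]_(p, m)) (Ch : T -> 'M[R]_(n, m)),
  iid_centered_normal sigma E ->
  (forall w : T,
     is_argmin (A * sigma * Num.sqrt (m%:R + ln n%:R)) r
       (X *m Bs + Cs + \matrix_(i < n, j < m) E (i, j) w) X (Bh w) (Ch w)) ->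
  measurable_fun [set: T] (fun w : T => Mloss X (Bh w - Bs) (Ch w - Cs)) ->
  forall (B : 'M[R]_(p, m)) (C : 'M[R]_(n, m)),
  (\rank B <= r)%N ->
  design_condition m r theta K X (row_supp C) ->
  ('E_P[fun w : T => Mloss X (Bh w - Bs) (Ch w - Cs)] <=
   (c * (Mloss X (B - Bs) (C - Cs)
         + sigma ^+ 2
         + sigma ^+ 2 * (\rank X + m)%:R * r%:R
         + sigma ^+ 2 * K ^+ 2 * #|row_supp C|%:R * (m%:R + ln n%:R)))%:E)%E.
Proof.
pose ep := theta / (2 + theta).
have th2 : 0 < 2 + theta by rewrite addr_gt0.
have ep0 : 0 < ep by rewrite divr_gt0.
(* 20 ^ 2 = 400 exceeds 32 * 12 = 384, the factor that the noise bounds demand of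
   [(ep * lam) ^+ 2]. *)
exists (20 / ep); split; first by rewrite divr_gt0.
move=> A A20; have A0 : 0 < A by rewrite (lt_le_trans _ A20)// divr_gt0.
have epA : 20 <= ep * A by rewrite mulrC -ler_pdivrMr.
exists (16 * A ^+ 2 + 100 ^+ 2 + 32 ^+ 2 * expR 1).
split; first by rewrite !addr_gt0 ?mulr_gt0 ?exprn_gt0 ?expR_gt0.
move=> n m p r sigma K s0 K0 X Bs Cs d T P E Bh Ch iidE Bh_min mM B C rB design.
(* For [n = 0] the logarithm takes its default value 0. *)
have ln0 : 0 <= ln (n%:R : R).
  by case: (n) => [|k]; [rewrite ln0|rewrite ln_ge0// ler1n].
pose g : R := m%:R + ln n%:R.
have g0 : 0 <= g by rewrite addr_ge0.
pose lam := A * sigma * Num.sqrt g.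
have lam0 : 0 <= lam by rewrite mulr_ge0 ?sqrtr_ge0// mulr_ge0 ?ltW.
have lam2 : lam ^+ 2 = A ^+ 2 * sigma ^+ 2 * g by rewrite !exprMn sqr_sqrtr.
have s20 : 0 <= sigma ^+ 2 by exact: sqr_ge0.
have elg : 32 * 12 * sigma ^+ 2 * g <= (ep * lam) ^+ 2.
  have : 20 ^+ 2 <= (ep * A) ^+ 2 by rewrite lerXn2r ?nnegrE// (le_trans _ epA).
  move=> /(ler_wpM2r (mulr_ge0 s20 g0));
  rewrite [(ep * lam) ^+ 2]exprMn lam2 [(ep * A) ^+ 2]exprMn.
  have := mulr_ge0 s20 g0; rewrite (_ : 20 ^+ 2 = 400); last by ring.
  by lra.
pose k := (2 * r)%N; pose q := \rank X.
(* One net for each row set, built from the masked design, whose rank is at most [\rank X]. *)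
have net J := rank_ball_net m k (mxrankM_maxr (row_mask R J) X).
pose I J := sval (cid (net J)).
pose D J := sval (cid (svalP (cid (net J)))).
have netP J := svalP (cid (svalP (cid (net J)))).
pose N := (k * (q + m))%N.
pose t (J : {set 'I_n}) := Num.sqrt (12 * sigma ^+ 2 * (1 + N%:R + #|J|%:R * g)).
have tE J : t J ^+ 2 = 12 * sigma ^+ 2 * (1 + N%:R + #|J|%:R * g).
  rewrite sqr_sqrtr//; apply: mulr_ge0; first exact: mulr_ge0.
  by rewrite addr_ge0 ?mulr_ge0// addr_ge0.
have SE := @noise_mean_le _ _ _ P n m N sigma (ep * lam) E I D t s0 iidE ln0 elg
  (fun J => let: And3 H _ _ := netP J in H)
  (fun J => let: And3 _ H _ := netP J in H) tE.
pose Ew w : 'M[R]_(n, m) := \matrix_(i, j) E (i, j) w.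
move: SE; rewrite /= -/Ew; set S := (X in mean_le _ X _).
set b := (X in mean_le _ _ X) => SE.
pose c1 := 3 * Mloss X (B - Bs) (C - Cs)
  + 16 * lam ^+ 2 * K ^+ 2 * #|row_supp C|%:R.
have M0 : 0 <= Mloss X (B - Bs) (C - Cs) by exact: sqr_ge0.
have c10 : 0 <= c1.
  apply: addr_ge0; first exact: mulr_ge0.
  apply: mulr_ge0 => //; apply: mulr_ge0 (sqr_ge0 K).
  exact: mulr_ge0 (sqr_ge0 lam).
have MS w : Mloss X (Bh w - Bs) (Ch w - Cs) <= c1 + 4 * S w.
  apply: (oracle_inequality htheta K0 lam0 rB (Bh_min w) design) => V W rV.
  rewrite -/ep; apply: (noise_bound (k := k) (g := g) (sigma := sigma) (T := t)) => //.
  - exact: mulr_ge0 (ltW ep0) lam0.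
  - by move=> J G V' rV'; case: (netP J) => _ _; apply.
  - by move=> J; rewrite sqrtr_ge0.
have [mS S0 Sb] := mean_leD (mean_le_cst P c10) (mean_leZ (ler0n R 4) SE).
rewrite unlock; apply: (@le_trans _ _ (\int[P]_w (c1 + 4 * S w)%:E)%E).
  apply: ge0_le_integral => //.
  - by move=> w _; rewrite lee_fin sqr_ge0.
  - exact/measurable_EFinP.
  - exact/measurable_EFinP.
  - by move=> w _; rewrite lee_fin.
apply: le_trans Sb _; rewrite lee_fin.
have NE : N%:R = 2 * ((q + m)%:R * r%:R) :> R by rewrite /N /k !natrM; ring.
rewrite /c1 /b NE lam2 /g -/q.
have A20' : 0 <= A ^+ 2 := sqr_ge0 A.
have e0 : 0 <= expR 1 :> R := expR_ge0 1.
set u : R := (q + m)%:R * r%:R; set v : R := K ^+ 2 * #|row_supp C|%:R * (m%:R + ln n%:R).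
have u0 : 0 <= u by exact: mulr_ge0.
have v0 : 0 <= v by rewrite mulr_ge0// mulr_ge0// sqr_ge0.
rewrite (_ : 16 * _ * _ * _ = 16 * A ^+ 2 * (sigma ^+ 2 * v)); last by rewrite /v; ring.
rewrite (_ : sigma ^+ 2 * K ^+ 2 * _ * _ = sigma ^+ 2 * v); last by rewrite /v; ring.
rewrite -[sigma ^+ 2 * _ * r%:R]mulrA -/u.
exact: risk_constants_le.
Qed.
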